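(* Let $g \geq 2$ and $n \geq 0$ be integers, and let $\theta \colon \pi_1 \Sigma_{g,n} \rightarrow Q$ be a surjective homomorphism onto a nontrivial finite solvable group $Q$ of odd order. Then there exists a normal finite-degree cover $\widetilde{\Sigma} \rightarrow \Sigma_{g,n}$ such that $\mathrm{H}_1^{\theta \neq 1}(\widetilde{\Sigma};\mathbb{Q}) \neq \mathrm{H}_1(\widetilde{\Sigma};\mathbb{Q})$. Furthermore, the cover may be chosen so that all prime factors of its degree divide $|Q|$.
   Context: $\Sigma_{g,n}$ denotes the connected orientable surface of genus $g$ with $n$ punctures. Covers are (unbranched) connected covering spaces. Given a finite-degree cover $\widetilde{\Sigma} \to \Sigma$, an elevation of a loop $\gamma$ on $\Sigma$ is a minimal concatenation of lifts of $\gamma$ which forms a closed curve in $\widetilde{\Sigma}$. For a set $\mathcal{O}$ of loops on $\Sigma$, $\mathrm{H}_1^{\mathcal{O}|\Sigma}(\widetilde{\Sigma};\mathbb{Q})$ is the subspace of $\mathrm{H}_1(\widetilde{\Sigma};\mathbb{Q})$ spanned by the classes $[\tilde\gamma]$ of all elevations $\tilde\gamma$ of all curves $\gamma\in\mathcal{O}$. For a quotient $\theta\colon\pi_1\Sigma\to Q$, $\mathrm{H}_1^{\theta\neq1}(\widetilde{\Sigma};\mathbb{Q}) = \mathrm{H}_1^{(\pi_1\Sigma\setminus\ker\theta)|\Sigma}(\widetilde{\Sigma};\mathbb{Q})$ is the subspace spanned by elevations of curves which are nontrivial in $Q$. Algebraically, if $R\leq\pi_1\Sigma$ is the finite-index subgroup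 corresponding to $\widetilde\Sigma$ and $\mathcal{O}\subseteq \pi_1\Sigma$ is closed under conjugation, then $\mathrm{H}_1^{\mathcal{O}|\Sigma}(\widetilde{\Sigma};\mathbb{Q})$ is the span in $\mathrm{H}_1(R;\mathbb{Q})$ of all classes $[x^m]$ with $x\in\mathcal{O}$, $m\in\mathbb{Z}$, $x^m\in R$. *)

(* Defs.v *)
From HB Require Import structures.
From mathcomp Require Import all_boot all_order all_algebra.
From mathcomp Require Import boolp classical_sets.
From mathcomp Require Import monalg.

Set Implicit Arguments.
Unset Strict Implicit.
Unset Printing Implicit Defensive.

Import GRing.Theory.
Local Open Scope quotient_scope.

(* A word over the alphabet X: the letter (x, false) stands for the generator
   x and the letter (x, true) for its inverse. *)
Notation word X := (seq (X * bool)).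

Section PresentedGroup.
Variables (X : choiceType) (rels : seq (word X)).

Inductive wequiv : word X -> word X -> Prop :=
| wequiv_refl u : wequiv u u
| wequiv_sym u v : wequiv u v -> wequiv v u
| wequiv_trans u v w : wequiv u v -> wequiv v w -> wequiv u w
| wequiv_cancel u v x b : wequiv (u ++ [:: (x, b); (x, ~~ b)] ++ v) (u ++ v)
| wequiv_rel u v r : r \in rels -> wequiv (u ++ r ++ v) (u ++ v).

Definition winv (u : word X) : word X := rev [seq (l.1, ~~ l.2) | l <- u].

Lemma winv_cons l u : winv (l :: u) = winv u ++ [:: (l.1, ~~ l.2)].
Proof. by rewrite /winv /= rev_cons -cats1. Qed.

Lemma winvK : involutive winv.
Proof.
move=> u; rewrite /winv map_rev revK -map_comp map_id_in //.
by move=> [x b] _ /=; rewrite negbK.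
Qed.

Lemma wequiv_cat u u' v v' :
  wequiv u u' -> wequiv v v' -> wequiv (u ++ v) (u' ++ v').
Proof.
move=> uu' vv'; apply: (@wequiv_trans _ (u' ++ v)).
  elim: uu' => {u u'} [u|u w _|u w z _ + _|u w x b|u w r rin].
  - exact: wequiv_refl.
  - exact: wequiv_sym.
  - exact: wequiv_trans.
  - by rewrite -!catA; apply: (wequiv_cancel u (w ++ v)).
  - by rewrite -!catA; apply: (wequiv_rel u (w ++ v)).
elim: vv' => {v v'} [v|v w _|v w z _ + _|v w x b|v w r rin].
- exact: wequiv_refl.
- exact: wequiv_sym.
- exact: wequiv_trans.
- by rewrite !catA -[(_ ++ _) ++ w]catA; apply: wequiv_cancel.
- by rewrite !catA -[(_ ++ _) ++ w]catA; apply: wequiv_rel.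
Qed.

Lemma wequivVl u : wequiv (winv u ++ u) [::].
Proof.
elim: u => [|[x b] u IHu]; first exact: wequiv_refl.
rewrite winv_cons -catA /=; apply: wequiv_trans IHu.
have := wequiv_cancel (winv u) u x (~~ b).
by rewrite negbK.
Qed.

Lemma wequivVr u : wequiv (u ++ winv u) [::].
Proof. by rewrite -{1}[u]winvK; apply: wequivVl. Qed.

Lemma wequivV u v : wequiv u v -> wequiv (winv u) (winv v).
Proof.
move=> uv; apply: (@wequiv_trans _ (winv u ++ (v ++ winv v))).
  rewrite -{1}[winv u]cats0; apply/wequiv_cat; first exact: wequiv_refl.
  exact/wequiv_sym/wequivVr.
rewrite catA -{2}[winv v]cat0s; apply: wequiv_cat; last exact: wequiv_refl.
apply: wequiv_trans (wequivVl u); apply: wequiv_cat; first exact: wequiv_refl.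
exact: wequiv_sym.
Qed.

Definition wequivb (u v : word X) : bool := `[< wequiv u v >].

Lemma wequivb_equiv : equiv_class_of wequivb.
Proof.
split=> [u|u v|v u w]; first exact/asboolP/wequiv_refl.
  by apply/asboolP/asboolP => /wequiv_sym.
by move=> /asboolP uv /asboolP vw; apply/asboolP/(wequiv_trans uv vw).
Qed.

Canonical wequivb_rel := EquivRelPack wequivb_equiv.
Canonical wequivb_encModRel := defaultEncModRel wequivb.

Definition presented_group := {eq_quot wequivb}.
HB.instance Definition _ := Choice.on presented_group.
HB.instance Definition _ : EqQuotient _ wequivb presented_group :=
  EqQuotient.on presented_group.

Definition of_word (u : word X) : presented_group := \pi_presented_group u.

Lemma of_wordP u v : of_word u = of_word v <-> wequiv u v.
Proof. by split=> [/eqmodP/asboolP|uv] //; apply/eqmodP/asboolP. Qed.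

Definition pmul (a b : presented_group) := of_word (repr a ++ repr b).
Definition pinv (a : presented_group) := of_word (winv (repr a)).

Lemma of_wordK u : wequiv (repr (of_word u)) u.
Proof. by apply/of_wordP; rewrite /of_word reprK. Qed.

Lemma pmulE u v : pmul (of_word u) (of_word v) = of_word (u ++ v).
Proof. by apply/of_wordP/wequiv_cat; apply: of_wordK. Qed.

Lemma pinvE u : pinv (of_word u) = of_word (winv u).
Proof. by apply/of_wordP/wequivV/of_wordK. Qed.

Lemma pmulA : associative pmul.
Proof.
move=> a b c; rewrite -[a]reprK -[b]reprK -[c]reprK -!/(of_word _).
by rewrite !pmulE catA.
Qed.

Lemma pmul1 : left_id (of_word [::]) pmul.
Proof. by move=> a; rewrite -[a]reprK -!/(of_word _) pmulE. Qed.

Lemma pmulr1 : right_id (of_word [::]) pmul.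
Proof. by move=> a; rewrite -[a]reprK -!/(of_word _) pmulE cats0. Qed.

Lemma pmulV : left_inverse (of_word [::]) pinv pmul.
Proof.
move=> a; rewrite -[a]reprK -!/(of_word _) pinvE pmulE.
exact/of_wordP/wequivVl.
Qed.

Lemma pmulrV : right_inverse (of_word [::]) pinv pmul.
Proof.
move=> a; rewrite -[a]reprK -!/(of_word _) pinvE pmulE.
exact/of_wordP/wequivVr.
Qed.

HB.instance Definition _ :=
  isGroup.Build presented_group pmulA pmul1 pmulr1 pmulV pmulrV.

End PresentedGroup.

Section SurfaceGroup.
Variables g n : nat.

(* Generators a_i, b_i (i < g) of the handles and c_j (j < n) of the loops
   around the punctures. *)
Definition surface_gen : choiceType := ('I_g + 'I_g + 'I_n)%type.
Definition gen_a (i : 'I_g) : surface_gen := inl (inl i).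
Definition gen_b (i : 'I_g) : surface_gen := inl (inr i).
Definition gen_c (j : 'I_n) : surface_gen := inr j.

Definition surface_relator : word surface_gen :=
  flatten [seq [:: (gen_a i, false); (gen_b i, false);
                   (gen_a i, true); (gen_b i, true)] | i <- enum 'I_g]
  ++ [seq (gen_c j, false) | j <- enum 'I_n].

(* The fundamental group of the connected orientable surface of genus g with
   n punctures, by its standard presentation
   < a_i, b_i, c_j | [a_0, b_0] ... [a_(g-1), b_(g-1)] c_0 ... c_(n-1) >. *)
Definition pi1_surface : groupType :=
  presented_group [:: surface_relator].

End SurfaceGroup.

Section LinearSpan.
Local Open Scope ring_scope.
Local Open Scope classical_set_scope.
Variables (K : pzRingType) (V : lmodType K).

Definition lspan (A : set V) : set V :=
  [set v | exists2 s : seq (K * V), (forall p, p \in s -> A p.2) &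
           v = \sum_(p <- s) p.1 *: p.2].

Definition lspan_pred (A : set V) : {pred V} := fun v => `[< lspan A v >].

Lemma lspan_submod_closed A : submod_closed (lspan_pred A).
Proof.
split; first by apply/asboolP; exists [::]; rewrite ?big_nil.
move=> a u v /asboolP[s sA ->] /asboolP[t tA ->]; apply/asboolP.
exists ([seq (a * p.1, p.2) | p <- s] ++ t).
  move=> p; rewrite mem_cat => /orP[/mapP[q qs ->]|]; last exact: tA.
  exact: sA qs.
rewrite big_cat big_map scaler_sumr /=; congr (_ + _).
by apply: eq_bigr => p _; rewrite scalerA.
Qed.

HB.instance Definition _ A :=
  GRing.isZmodClosed.Build V (lspan_pred A)
    (GRing.submod_closedB (lspan_submod_closed A)).

Lemma lspanZ A a v : lspan A v -> lspan A (a *: v).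
Proof.
case: (lspan_submod_closed A) => A0 AZD /asboolP Av.
by apply/asboolP; rewrite -[a *: v]addr0; apply: AZD.
Qed.

End LinearSpan.

Section QuotientBySpan.
Local Open Scope ring_scope.
Variables (K : pzRingType) (V : lmodType K) (A : set V).

Let S : zmodClosed V := lspan_pred A.

Definition span_quot : Type := Quotient.quot S.
HB.instance Definition _ := GRing.Zmodule.on span_quot.

Definition to_span_quot (u : V) : span_quot := \pi_(Quotient.quot S) u.

Lemma to_span_quotP u v : to_span_quot u = to_span_quot v <-> lspan A (u - v).
Proof.
rewrite /to_span_quot; split=> [/eqP|uv].
  by rewrite -Quotient.idealrBE => /asboolP.
by apply/eqP; rewrite -Quotient.idealrBE; apply/asboolP.
Qed.

Lemma to_span_quotD : {morph to_span_quot : u v / u + v}.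
Proof. by move=> u v; rewrite /to_span_quot raddfD. Qed.

Lemma to_span_quotK (v : span_quot) : {u : V | v = to_span_quot u}.
Proof. by exists (repr v); rewrite /to_span_quot reprK. Qed.

Definition span_quot_scale (a : K) (v : span_quot) : span_quot :=
  to_span_quot (a *: repr v).

Lemma span_quot_scaleE a u :
  span_quot_scale a (to_span_quot u) = to_span_quot (a *: u).
Proof.
apply/to_span_quotP; rewrite -scalerBr.
by apply/lspanZ/to_span_quotP; apply: reprK.
Qed.

Lemma span_quot_scaleA a b v :
  span_quot_scale a (span_quot_scale b v) = span_quot_scale (a * b) v.
Proof. by have [u ->] := to_span_quotK v; rewrite !span_quot_scaleE scalerA. Qed.

Lemma span_quot_scale1 : left_id 1 span_quot_scale.
Proof.
by move=> v; have [u ->] := to_span_quotK v; rewrite span_quot_scaleE scale1r.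
Qed.

Lemma span_quot_scaleDr : right_distributive span_quot_scale +%R.
Proof.
move=> a v w; have [u ->] := to_span_quotK v; have [t ->] := to_span_quotK w.
by rewrite -to_span_quotD !span_quot_scaleE scalerDr to_span_quotD.
Qed.

Lemma span_quot_scaleDl v : {morph span_quot_scale^~ v : a b / a + b}.
Proof.
move=> a b; have [u ->] := to_span_quotK v.
by rewrite !span_quot_scaleE scalerDl to_span_quotD.
Qed.

HB.instance Definition _ := GRing.Zmodule_isLmodule.Build K span_quot
  span_quot_scaleA span_quot_scale1 span_quot_scaleDr span_quot_scaleDl.

End QuotientBySpan.

Section Homology.
Local Open Scope ring_scope.
Local Open Scope classical_set_scope.
Variable G : groupType.

(* The differential C_2 -> C_1 of the bar complex of G with trivial
   coefficients in rat, on the basis; the differential C_1 -> C_0 vanishes. *)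
Definition bar_d2 (x y : G) : {malg rat[G]} :=
  << y >> - << (x * y)%g >> + << x >>.

Definition bar_boundaries : set {malg rat[G]} :=
  [set c | exists x y, c = bar_d2 x y].

Definition H1 : lmodType rat := span_quot bar_boundaries.
Definition H1_class (x : G) : H1 := to_span_quot bar_boundaries << x >>.

End Homology.

Definition expgz (G : groupType) (x : G) (m : int) : G :=
  match m with Posz k => (x ^+ k)%g | Negz k => (x ^- k.+1)%g end.

Section Covers.
Local Open Scope group_scope.
Local Open Scope classical_set_scope.
Variable G : groupType.

(* Connected covers of a surface with fundamental group G correspond to
   subgroups R of G; the cover is normal iff R is, and its degree is [G : R]. *)
Definition subgroup_of (R : groupClosed G) := {x : G | x \in R}.
HB.instance Definition _ R := SubChoice.on (subgroup_of R).

Lemma subgroup_closed (R : groupClosed G) : group_closed R.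
Proof. by split; [exact: gpred1 | exact: gpredF]. Qed.

HB.instance Definition _ (R : groupClosed G) :=
  SubChoice_isSubGroup.Build G (mem R) (subgroup_of R) (subgroup_closed R).

Definition normal_subgroup (R : groupClosed G) : Prop :=
  forall x y, x \in R -> x ^ y \in R.

Definition has_index (R : groupClosed G) (d : nat) : Prop :=
  exists t : 'I_d -> G, forall x, exists! i, (t i)^-1 * x \in R.

(* An elevation of a loop x is a minimal power of a conjugate of x that lies
   in R, and every power of it in R is a multiple in homology. So for O closed
   under conjugation the span of the classes of the elevations of the loops in
   O is that of all powers of elements of O that lie in R. *)
Definition H1_elevations (O : set G) (R : groupClosed G) :
    set (H1 (subgroup_of R)) :=
  lspan [set h | exists x m (xmR : expgz x m \in R),
           O x /\ h = H1_class (Sub (expgz x m) xmR)].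

Definition H1_neq1 (Q : groupType) (theta : {multiplicative G -> Q})
    (R : groupClosed G) : set (H1 (subgroup_of R)) :=
  @H1_elevations [set x | theta x <> 1] R.

End Covers.

Arguments H1_elevations {G} O R.
Arguments H1_neq1 {G Q} theta R.

(* Main.v *)
(* Let K be the kernel of theta. Suppose that no x outside K fixes a nonzero vector
   of a finite-dimensional module V on which G acts through a finite group, with
   kernel R. A crossed homomorphism c : G -> V restricts to a homomorphism on R,
   and for x outside K it kills x^m whenever x^m lies in R, as c (x^m) is fixed by
   x. Since G has 2 g + n generators and one relator, there is a non-principal c,
   which is nonzero on R, so the elevations do not span H_1(R; Q).

   V consists of the functions on a finite G-set T, twisted by a cocycle with
   values in the roots of unity that is nontrivial on some power of x fixing t, for
   all x outside K and t in T. It suffices to treat the x of prime order p modulo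
   K, for each p separately: the elements of K act on the p-th factor of T with
   p-power order, so that the factors do not interfere. For such x, the integral
   homology of subgroups of G being torsion-free, x^p is nonzero in H_1(K; F_p), so
   it is detected by one of finitely many classes in H^1(K; F_p). On p-covers these
   are merged two at a time into a single class that is nonzero on a p-power of x;
   the obstructions live in H^2 and vanish on a cover of degree divisible by p. *)

Require Import Defs.
From HB Require Import structures.
From mathcomp Require Import all_boot all_order all_algebra.
From mathcomp Require Import all_fingroup all_solvable all_field.
From mathcomp Require Import boolp classical_sets.
From mathcomp Require Import monalg zify.

Set Implicit Arguments.
Unset Strict Implicit.
Unset Printing Implicit Defensive.

Import GRing.Theory.
Local Open Scope ring_scope.

(** * Crossed homomorphisms on presented groups *)

Record gmodule (G : groupType) := GModule {
  gmod_sort :> zmodType;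
  gmod_act : G -> gmod_sort -> gmod_sort;
  gmod_actD : forall x, {morph gmod_act x : u v / u + v};
  gmod_act1 : forall m, gmod_act 1%g m = m;
  gmod_actM : forall x y m, gmod_act (x * y)%g m = gmod_act x (gmod_act y m)
}.

Section GModuleTheory.
Variables (G : groupType) (M : gmodule G).
Implicit Types (x y : G) (m : M).

Lemma gmod_act0 x : gmod_act x 0 = 0 :> M.
Proof. by apply: (addrI (gmod_act x 0)); rewrite -gmod_actD !addr0. Qed.

Lemma gmod_actN x m : gmod_act x (- m) = - gmod_act x m.
Proof. by apply: (addrI (gmod_act x m)); rewrite -gmod_actD !subrr gmod_act0. Qed.

Lemma gmod_actVK x m : gmod_act x (gmod_act x^-1%g m) = m.
Proof. by rewrite -gmod_actM mulgV gmod_act1. Qed.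

Definition crossed (c : G -> M) :=
  forall x y, c (x * y)%g = c x + gmod_act x (c y).

End GModuleTheory.

Section Fox.
Variables (X : choiceType) (rels : seq (word X)).
Let G : groupType := presented_group rels.
Variable M : gmodule G.
Implicit Types (d : X -> M) (u v : word X).

Definition pgen (x : X) : G := of_word rels [:: (x, false)].

Lemma of_word_cat u v : of_word rels (u ++ v) = (of_word rels u * of_word rels v)%g.
Proof. by rewrite -pmulE. Qed.

Lemma of_word_nil : of_word rels [::] = 1%g.
Proof. by []. Qed.

Lemma of_wordV u : of_word rels (winv u) = (of_word rels u)^-1%g.
Proof. by rewrite -pinvE. Qed.

Lemma of_word_letter x b :
  of_word rels [:: (x, b)] = (if b then (pgen x)^-1 else pgen x)%g.
Proof. by case: b; rewrite // /pgen -of_wordV. Qed.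

Lemma of_word_repr (x : G) : {u : word X | x = of_word rels u}.
Proof. by exists (generic_quotient.repr x); rewrite /of_word reprK. Qed.

Lemma of_word_rel r : r \in rels -> of_word rels r = 1%g.
Proof.
move=> rin; apply/of_wordP; rewrite -[r]cats0 -[r ++ _]cat0s.
exact: (wequiv_rel [::] [::] rin).
Qed.

(* The extension of d to words by the crossed homomorphism rule, that is, the
   Fox calculus: ev d u is the sum of the du/dx acting on d x. *)
Definition ev_letter d (l : X * bool) : M :=
  if l.2 then - gmod_act (pgen l.1)^-1%g (d l.1) else d l.1.

Fixpoint ev d u : M :=
  if u is l :: u' then ev_letter d l + gmod_act (of_word rels [:: l]) (ev d u')
  else 0.

Lemma ev_pgen d x : ev d [:: (x, false)] = d x.
Proof. by rewrite /= gmod_act0 addr0. Qed.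

Lemma ev_cat d u v : ev d (u ++ v) = ev d u + gmod_act (of_word rels u) (ev d v).
Proof.
elim: u => [|l u IHu] /=; first by rewrite add0r of_word_nil gmod_act1.
by rewrite IHu gmod_actD addrA -gmod_actM -of_word_cat.
Qed.

Lemma evD d1 d2 u : ev (fun x => d1 x + d2 x) u = ev d1 u + ev d2 u.
Proof.
elim: u => [|[x b] u IHu] /=; first by rewrite addr0.
rewrite IHu gmod_actD addrACA; congr (_ + _).
by rewrite /ev_letter; case: b => //=; rewrite gmod_actD opprD.
Qed.

Lemma evN d u : ev (fun x => - d x) u = - ev d u.
Proof.
elim: u => [|[x b] u IHu] /=; first by rewrite oppr0.
rewrite IHu gmod_actN opprD; congr (_ + _).
by rewrite /ev_letter; case: b => //=; rewrite gmod_actN.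
Qed.

Lemma ev_supp0 d u : (forall l, l \in u -> d l.1 = 0) -> ev d u = 0.
Proof.
elim: u => [//|[x b] u IHu] du /=.
rewrite IHu => [|l lu]; last by apply: du; rewrite inE lu orbT.
have dx : d x = 0 by apply: (du (x, b)); rewrite inE eqxx.
by rewrite gmod_act0 addr0 /ev_letter /= dx; case: b {du};
   rewrite ?gmod_act0 ?oppr0.
Qed.

(** A cancelling pair of letters contributes 0 and acts trivially, and so does a relator on which
    [ev d] vanishes; deleting either does not change the value. Hence [ev d] descends to the
    group. *)
Lemma ev_wequiv d u v : (forall r, r \in rels -> ev d r = 0) ->
  wequiv rels u v -> ev d u = ev d v.
Proof.
move=> dr; elim=> {u v} [//|u v _ -> //|u v w _ -> _ -> //|u v x b|u v r rin].
  rewrite !ev_cat; congr (_ + gmod_act _ _).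
  have -> : of_word rels [:: (x, b); (x, ~~ b)] = 1%g.
    rewrite -cat1s of_word_cat !of_word_letter.
    by case: b; rewrite /= ?mulVg ?mulgV.
  rewrite gmod_act1 -[RHS]add0r; congr (_ + _).
  rewrite /= gmod_act0 addr0 of_word_letter /ev_letter.
  by case: b => /=; rewrite ?addNr // gmod_actN gmod_actVK subrr.
by rewrite !ev_cat (dr r rin) (of_word_rel rin) gmod_act1 add0r.
Qed.

Lemma crossed_of_ev d : (forall r, r \in rels -> ev d r = 0) ->
  exists2 c : G -> M, crossed c & forall u, c (of_word rels u) = ev d u.
Proof.
move=> dr.
have cE u : ev d (generic_quotient.repr (of_word rels u)) = ev d u.
  exact/ev_wequiv/of_wordK.
exists (fun x : G => ev d (generic_quotient.repr x)) => // x y.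
have [u ->] := of_word_repr x; have [v ->] := of_word_repr y.
by rewrite -of_word_cat !cE ev_cat.
Qed.

Lemma crossed_ev (c : G -> M) : crossed c ->
  forall u, c (of_word rels u) = ev (c \o pgen) u.
Proof.
move=> cM; have c1 : c 1%g = 0.
  have /(congr1 (fun m => m - c 1%g)) := cM 1%g 1%g.
  by rewrite mulg1 gmod_act1 subrr addrK => <-.
elim=> [|[x b] u IHu]; first by rewrite of_word_nil.
rewrite -cat1s of_word_cat cM IHu ev_cat; congr (_ + _).
rewrite of_word_letter /= gmod_act0 addr0 /ev_letter /=; case: b => //.
have /esym/eqP := cM (pgen x)^-1%g (pgen x).
by rewrite mulVg c1 addr_eq0 => /eqP.
Qed.

End Fox.

Section FoxMorphisms.
Variables (X : choiceType) (rels : seq (word X)).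
Let G : groupType := presented_group rels.

Lemma ev_map (M M' : gmodule G) (h : M -> M') (d : X -> M) u :
  {morph h : a b / a + b} -> (forall x m, h (gmod_act x m) = gmod_act x (h m)) ->
  h (ev d u) = ev (h \o d) u.
Proof.
move=> hD hA; have h0 : h 0 = 0.
  have /(congr1 (fun m => m - h 0)) := hD 0 0.
  by rewrite addr0 subrr addrK.
have hN m : h (- m) = - h m.
  by apply/eqP; rewrite -addr_eq0 -hD addNr h0.
elim: u => [//|[x b] u IHu] /=; rewrite hD hA IHu; congr (_ + _).
by rewrite /ev_letter; case: b => //=; rewrite hN hA.
Qed.

Lemma crossed_map (M M' : gmodule G) (h : M -> M') (c : G -> M) :
  {morph h : a b / a + b} -> (forall x m, h (gmod_act x m) = gmod_act x (h m)) ->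
  crossed c -> crossed (h \o c).
Proof. by move=> hD hA cM x y; rewrite /= cM hD hA. Qed.

Section Closed.
Variables (M : gmodule G) (N : M -> Prop).
Hypotheses (N0 : N 0) (ND : forall u v, N u -> N v -> N (u + v))
  (NN : forall u, N u -> N (- u)) (NA : forall x u, N u -> N (gmod_act x u)).

Lemma ev_closed (d : X -> M) u : (forall x, N (d x)) -> N (ev d u).
Proof.
move=> Nd; elim: u => [//|[x b] u IHu] /=; apply: ND; last exact: NA.
by rewrite /ev_letter; case: b => //=; apply/NN/NA.
Qed.

Lemma crossed_closed (c : G -> M) x :
  crossed c -> (forall y, N (c (pgen _ y))) -> N (c x).
Proof.
move=> cM Nc; have [u ->] := of_word_repr x.
by rewrite crossed_ev //; apply: ev_closed.
Qed.

End Closed.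

Lemma crossed_eq (M : gmodule G) (c c' : G -> M) :
  crossed c -> crossed c' -> (forall y, c (pgen _ y) = c' (pgen _ y)) -> c =1 c'.
Proof.
move=> cM c'M cc' x; have [u ->] := of_word_repr x.
rewrite !crossed_ev //; elim: u => [//|[y b] u IHu] /=; congr (_ + _).
  by rewrite /ev_letter /= cc'.
by rewrite IHu.
Qed.

End FoxMorphisms.

(** * Duality for surface groups *)

Section SurfaceDuality.
Variables g n : nat.
Local Notation G := (pi1_surface g n).
Local Notation rels := [:: surface_relator g n].
Local Notation wd := (of_word rels).
Variable M : gmodule G.
Variable N : M -> Prop.
Hypotheses (N0 : N 0) (ND : forall u v, N u -> N v -> N (u + v))
  (NN : forall u, N u -> N (- u)) (NA : forall x u, N u -> N (gmod_act x u)).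

(* The values of the relator on cochains with coefficients in the submodule N,
   i.e., the 2-coboundaries. *)
Definition relator_value (D : M) :=
  exists2 d : surface_gen g n -> M,
    forall x, N (d x) & ev d (surface_relator g n) = D.

Lemma relator_value0 : relator_value 0.
Proof. by exists (fun=> 0) => //; apply: ev_supp0. Qed.

Lemma relator_valueD D1 D2 :
  relator_value D1 -> relator_value D2 -> relator_value (D1 + D2).
Proof.
move=> [d1 Nd1 <-] [d2 Nd2 <-]; exists (fun x => d1 x + d2 x); last exact: evD.
by move=> x; apply: ND.
Qed.

Lemma relator_valueN D : relator_value D -> relator_value (- D).
Proof.
move=> [d Nd <-]; exists (fun x => - d x); last exact: evN.
by move=> x; apply: NN.
Qed.

Lemma relator_value_sum (I : Type) (s : seq I) (P : pred I) (F : I -> M) :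
  (forall i, P i -> relator_value (F i)) ->
  relator_value (\sum_(i <- s | P i) F i).
Proof.
by move=> FP; elim/big_ind: _ => //; [exact: relator_value0 | exact: relator_valueD].
Qed.

Definition handle (i : 'I_g) : word (surface_gen g n) :=
  [:: (gen_a n i, false); (gen_b n i, false); (gen_a n i, true);
      (gen_b n i, true)].

Definition handles (s : seq 'I_g) := flatten [seq handle i | i <- s].
Definition punctures : word (surface_gen g n) :=
  [seq (gen_c g j, false) | j <- enum 'I_n].

Lemma surface_relatorE : surface_relator g n = handles (enum 'I_g) ++ punctures.
Proof. by []. Qed.

Lemma mem_handles s l : l \in handles s ->
  exists2 i, i \in s & (l.1 = gen_a n i) \/ (l.1 = gen_b n i).
Proof.
move=> /flatten_mapP[i si]; rewrite !inE => li; exists i => //.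
by case/or4P: li => /eqP -> /=; [left|right|left|right].
Qed.

Definition single (y : surface_gen g n) (m : M) (x : surface_gen g n) : M :=
  if x == y then m else 0.

Lemma N_single y m x : N m -> N (single y m x).
Proof. by rewrite /single; case: ifP. Qed.

(** The generator of a puncture occurs exactly once in the relator, so its Fox derivative is the
    group element of the prefix [u], which is invertible. A cochain supported on that generator
    reaches every value. *)
Lemma relator_value_puncture m : (0 < n)%N -> N m -> relator_value m.
Proof.
move=> n_gt0 Nm; pose j0 : 'I_n := Ordinal n_gt0.
have /(mem_nth j0) : (0 < size (enum 'I_n))%N by rewrite size_enum_ord.
set c := nth _ _ _; set s := enum 'I_n => cs.
have [s1 [s2 [es c1 c2]]] : exists s1 s2 : seq 'I_n,
    [/\ s = s1 ++ c :: s2, c \notin s1 & c \notin s2].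
  have := enum_uniq 'I_n; rewrite -/s; case/splitPr: cs => s1 s2.
  rewrite cat_uniq /= => /and4P[_ /norP[c1 _] c2 _].
  by exists s1, s2.
pose u := handles (enum 'I_g) ++ [seq (gen_c g j, false) | j <- s1].
pose m' := gmod_act (wd u)^-1%g m.
exists (single (gen_c g c) m') => [x|]; first exact/N_single/NA.
have relE : surface_relator g n =
    u ++ [:: (gen_c g c, false)] ++ [seq (gen_c g j, false) | j <- s2].
  by rewrite surface_relatorE /punctures -/s es map_cat map_cons -cat1s !catA.
rewrite (congr1 (ev _) relE) (ev_cat _ u) (ev_cat _ [:: _]).
rewrite (@ev_supp0 _ _ _ _ u) ?(@ev_supp0 _ _ _ _ (map _ s2)).
- rewrite gmod_act0 addr0 add0r /= gmod_act0 addr0 /ev_letter /single /= eqxx.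
  exact: gmod_actVK.
- move=> l /mapP[j js ->] /=; rewrite /single; case: eqP => // -[jc].
  by rewrite -jc js in c2.
- move=> l; rewrite mem_cat => /orP[/mem_handles[i _ [->|->]] //|].
  move=> /mapP[j js ->] /=; rewrite /single; case: eqP => // -[jc].
  by rewrite -jc js in c1.
Qed.

(** These elements form a subgroup, so duality comes down to showing that it contains the
    generators. *)
Definition augmented (x : G) :=
  forall m, N m -> relator_value (gmod_act x m - m).

Lemma augmented1 : augmented 1%g.
Proof. by move=> m _; rewrite gmod_act1 subrr; apply: relator_value0. Qed.

Lemma augmentedM x y : augmented x -> augmented y -> augmented (x * y)%g.
Proof.
move=> Jx Jy m Nm; rewrite gmod_actM -[_ - m](subrKA (gmod_act y m)).
by apply: relator_valueD; [apply/Jx/NA | apply: Jy].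
Qed.

Lemma augmentedV x : augmented x -> augmented x^-1%g.
Proof.
move=> Jx m Nm; have := relator_valueN (Jx _ (NA x^-1%g Nm)).
by rewrite gmod_actVK opprB.
Qed.

Lemma augmented_word u :
  (forall l, l \in u -> augmented (pgen _ l.1)) -> augmented (wd u).
Proof.
elim: u => [_|[x b] u IHu Ju]; first exact: augmented1.
rewrite -(cat1s (x, b) u) of_word_cat; apply: augmentedM.
  rewrite of_word_letter; have Jx := Ju (x, b) (mem_head _ _).
  by case: b {Ju} Jx => //=; apply: augmentedV.
by apply: IHu => l lu; apply: Ju; rewrite inE lu orbT.
Qed.

(** Induction along the handles: the prefix [P] of the relator is augmented once the earlier
    generators are. The Fox derivatives by [a] and [b] are [P (1 - a b a^-1)] and
    [P (a - a b a^-1 b^-1)]. After rescaling the cochains, they show that the conjugates by [P] of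
    [a b a^-1] and [a b a^-1 b^-1 a^-1] are augmented; these two elements generate [a] and [b]. *)
Lemma augmented_handles (s s' : seq 'I_g) : enum 'I_g = s ++ s' ->
  forall i, i \in s ->
  augmented (pgen _ (gen_a n i)) /\ augmented (pgen _ (gen_b n i)).
Proof.
elim/last_ind: s s' => [//|s i IHs] s' es j.
rewrite mem_rcons inE => /orP[/eqP -> {j}|]; last first.
  by apply: (IHs (i :: s')); rewrite es cat_rcons.
have {}IHs := IHs (i :: s') (etrans es (cat_rcons _ _ _)).
have := enum_uniq 'I_g; rewrite es cat_rcons cat_uniq /=.
case/and4P=> _ /norP[is1 _] is2 _.
set a := pgen _ (gen_a n i); set b := pgen _ (gen_b n i).
pose P := wd (handles s).
have JP : augmented P.
  apply: augmented_word => l /mem_handles[k ks [->|->]];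
  by have [] := IHs k ks.
have relE : surface_relator g n = handles s ++ handle i ++ (handles s' ++ punctures).
  by rewrite surface_relatorE es cat_rcons /handles map_cat flatten_cat -!catA.
have evE x m : (x = gen_a n i) \/ (x = gen_b n i) ->
    ev (single x m) (surface_relator g n) =
    gmod_act P (ev (single x m) (handle i)).
  move=> xi; rewrite (congr1 (ev _) relE) !ev_cat.
  rewrite (@ev_supp0 _ _ _ _ (handles s)) => [|l].
    rewrite (@ev_supp0 _ _ _ _ (handles s')) => [|l].
      rewrite (@ev_supp0 _ _ _ _ punctures) => [|l].
        by rewrite !gmod_act0 !(add0r, addr0, gmod_act0).
      by move=> /mapP[k _ ->] /=; rewrite /single; case: xi => ->.
    move=> /mem_handles[k ks] lk; rewrite /single; case: eqP => // lx.
    have ki : k = i by case: lk lx => -> ; case: xi => -> [].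
    by rewrite -ki ks in is2.
  move=> /mem_handles[k ks] lk; rewrite /single; case: eqP => // lx.
  have ki : k = i by case: lk lx => -> ; case: xi => -> [].
  by rewrite -ki ks in is1.
have Ja : augmented (P * (a * b * a^-1) * P^-1)%g.
  move=> m Nm; rewrite -[_ - _]opprB; apply: relator_valueN.
  exists (single (gen_a n i) (gmod_act P^-1%g m)) => [x|].
    exact/N_single/NA.
  rewrite evE; last by left.
  rewrite /= /ev_letter /single /= !eqxx !of_word_letter -/a -/b.
  rewrite !(gmod_act0, addr0, oppr0, add0r) !(gmod_actD, gmod_actN).
  by rewrite gmod_actVK !gmod_actM.
have Jb : augmented (P * (a * b * a^-1 * b^-1 * a^-1) * P^-1)%g.
  move=> m Nm; rewrite -[_ - _]opprB; apply: relator_valueN.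
  exists (single (gen_b n i) (gmod_act (P * a)^-1%g m)) => [x|].
    exact/N_single/NA.
  rewrite evE; last by right.
  rewrite /= /ev_letter /single /= !eqxx !of_word_letter -/a -/b.
  rewrite !(gmod_act0, addr0, oppr0, add0r) !(gmod_actD, gmod_actN).
  by rewrite -!gmod_actM !invMg !mulgA mulgK mulgV gmod_act1.
have conjP x : augmented (P * x * P^-1)%g -> augmented x.
  move=> Jx; have := augmentedM (augmentedM (augmentedV JP) Jx) JP.
  by rewrite !mulgA mulVg mul1g mulgVK.
have {}Ja := conjP _ Ja; have {}Jb := conjP _ Jb.
have Jba : augmented (b^-1 * a^-1)%g.
  have := augmentedM (augmentedV Ja) Jb.
  by rewrite -[(_ * b^-1 * a^-1)%g]mulgA mulKg.
have Jab := augmentedV Jba; rewrite invMg !invgK in Jab.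
have Ja' : augmented a.
  have := augmentedM (augmentedV Ja) Jab.
  by rewrite !invMg !invgK !mulgA mulgVK mulgVK.
split=> //; have := augmentedM (augmentedV Ja') Jab.
by rewrite mulKg.
Qed.

(* Poincare duality: the second cohomology of a closed surface group, the cokernel
   of the Fox Jacobian of the relator, is the module of coinvariants. *)
Lemma relator_value_aug (x : G) m : N m -> relator_value (gmod_act x m - m).
Proof.
move=> Nm; have [n0|n_gt0] := posnP n; last first.
  by apply: relator_value_puncture => //; apply: ND; [apply: NA | apply: NN].
have [u ->] := of_word_repr x; apply: augmented_word Nm => -[[[i|i]|j] b] _ /=.
- by have [] := @augmented_handles (enum 'I_g) [::] (esym (cats0 _)) i (mem_enum _ i).
- by have [] := @augmented_handles (enum 'I_g) [::] (esym (cats0 _)) i (mem_enum _ i).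
- by have := ltn_ord j; rewrite [X in (_ < X)%N]n0.
Qed.

End SurfaceDuality.

(** * Cocycles on finite G-sets *)

Record gset (G : groupType) := GSet {
  gset_sort :> finType;
  gset_act : gset_sort -> G -> gset_sort;
  gset_act1 : forall t, gset_act t 1%g = t;
  gset_actM : forall t x y, gset_act t (x * y)%g = gset_act (gset_act t x) y
}.

Section GSetTheory.
Variable G : groupType.
Implicit Types (T : gset G) (x y : G).

Lemma gset_actK T (t : T) x : gset_act (gset_act t x) x^-1%g = t.
Proof. by rewrite -gset_actM mulgV gset_act1. Qed.

Lemma gset_act_inj T x : injective (fun t : T => gset_act t x).
Proof. by move=> s t /(congr1 (fun t => gset_act t x^-1%g)); rewrite !gset_actK. Qed.

Lemma gset_actX_fix T (t : T) x k : gset_act t x = t -> gset_act t (x ^+ k)%g = t.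
Proof.
by move=> tx; elim: k => [|k IHk]; rewrite ?gset_act1 // expgS gset_actM tx.
Qed.

Definition fixes T x := forall t : T, gset_act t x = t.

Definition transitive_gset T := forall s t : T, exists x, gset_act s x = t.

Definition equivariant T1 T2 (f : T1 -> T2) :=
  forall t x, f (gset_act t x) = gset_act (f t) x.

(* By Shapiro's lemma these represent the classes in H^1 of a point stabiliser
   with coefficients in A, when T is transitive. *)
Definition cocycle T (A : zmodType) (c : T -> G -> A) :=
  forall t x y, c t (x * y)%g = c t x + c (gset_act t x) y.

Section Cocycles.
Variables (T : gset G) (A : zmodType) (c : T -> G -> A).
Hypothesis cM : cocycle c.

Lemma cocycle1 t : c t 1%g = 0.
Proof.
have /(congr1 (fun m => m - c t 1%g)) := cM t 1%g 1%g.
by rewrite mulg1 gset_act1 subrr addrK.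
Qed.

Lemma cocycleV t x : c t x^-1%g = - c (gset_act t x^-1%g) x.
Proof. by apply/eqP; rewrite -addr_eq0 -cM mulVg cocycle1. Qed.

Lemma cocycleX t x k :
  c t (x ^+ k)%g = \sum_(i < k) c (gset_act t (x ^+ i)%g) x.
Proof.
elim: k => [|k IHk]; first by rewrite big_ord0 expg0 cocycle1.
by rewrite big_ord_recr /= -IHk expgSr cM.
Qed.

Lemma cocycleX_fix t x k : gset_act t x = t -> c t (x ^+ k)%g = c t x *+ k.
Proof.
move=> tx; rewrite cocycleX (eq_bigr (fun=> c t x)) => [|i _].
  by rewrite sumr_const card_ord.
by rewrite gset_actX_fix.
Qed.

Lemma cocycle_pull (T' : gset G) (f : T' -> T) :
  equivariant f -> cocycle (fun t => c (f t)).
Proof. by move=> fE t x y; rewrite fE. Qed.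

End Cocycles.

Lemma cocycleD T (A : zmodType) (c d : T -> G -> A) :
  cocycle c -> cocycle d -> cocycle (fun t x => c t x + d t x).
Proof. by move=> cM dM t x y; rewrite cM dM addrACA. Qed.

Lemma cocycleN T (A : zmodType) (c : T -> G -> A) :
  cocycle c -> cocycle (fun t x => - c t x).
Proof. by move=> cM t x y; rewrite cM opprD. Qed.

Section Extension.
Variables (T : gset G) (V : finZmodType) (c : T -> G -> V).
Hypothesis cM : cocycle c.

(** The cover with fibre [V] defined by [c]: the second coordinate is a function whose coboundary is
    the pullback of [c], so the class of [c] dies there. *)
Definition ext_act (t : T * V) x := (gset_act t.1 x, t.2 + c t.1 x).

Lemma ext_act1 t : ext_act t 1%g = t.
Proof. by case: t => t v; rewrite /ext_act gset_act1 cocycle1 // addr0. Qed.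

Lemma ext_actM t x y : ext_act t (x * y)%g = ext_act (ext_act t x) y.
Proof. by rewrite /ext_act gset_actM cM addrA. Qed.

Definition ext_gset : gset G :=
  @GSet G (T * V)%type ext_act ext_act1 ext_actM.

Lemma ext_fst_equivariant : equivariant (fun t : ext_gset => t.1 : T).
Proof. by []. Qed.

Lemma ext_fixesX k x :
  (forall v : V, v *+ k = 0) -> fixes T x -> fixes ext_gset (x ^+ k)%g.
Proof.
move=> kV Tx [t v]; rewrite /gset_act /= /ext_act /= gset_actX_fix //.
by rewrite cocycleX_fix // kV addr0.
Qed.

End Extension.

Section Orbit.
Variables (T : gset G) (t0 : T).

Definition orbit_pred : pred T := fun t => `[< exists x, gset_act t0 x = t >].
Definition orbit_sort := {t : T | orbit_pred t}.

Lemma orbit_act_subproof (t : orbit_sort) x : orbit_pred (gset_act (val t) x).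
Proof.
by case: t => t /= /asboolP[y <-]; apply/asboolP; exists (y * x)%g; rewrite gset_actM.
Qed.

Definition orbit_act (t : orbit_sort) x : orbit_sort :=
  Sub (gset_act (val t) x) (orbit_act_subproof t x).

Lemma orbit_act1 t : orbit_act t 1%g = t.
Proof. by apply: val_inj; rewrite /= gset_act1. Qed.

Lemma orbit_actM t x y : orbit_act t (x * y)%g = orbit_act (orbit_act t x) y.
Proof. by apply: val_inj; rewrite /= gset_actM. Qed.

(** Passing to an orbit restores the transitivity that an extension by a cocycle may lose. *)
Definition orbit_gset : gset G := @GSet G orbit_sort orbit_act orbit_act1 orbit_actM.

Lemma orbit_base_subproof : orbit_pred t0.
Proof. by apply/asboolP; exists 1%g; rewrite gset_act1. Qed.

Definition orbit_base : orbit_gset := Sub t0 orbit_base_subproof.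

Lemma orbit_transitive : transitive_gset orbit_gset.
Proof.
move=> [s Ps] [t Pt]; have [x sx] := asboolP _ Ps; have [y ty] := asboolP _ Pt.
by exists (x^-1 * y)%g; apply: val_inj; rewrite /= gset_actM -sx gset_actK.
Qed.

Lemma orbit_fixes x : fixes T x -> fixes orbit_gset x.
Proof. by move=> Tx t; apply: val_inj; rewrite /= Tx. Qed.

End Orbit.

Section Product.
Variables T1 T2 : gset G.

Definition prod_act (t : T1 * T2) x := (gset_act t.1 x, gset_act t.2 x).

Lemma prod_act1 t : prod_act t 1%g = t.
Proof. by case: t => t1 t2; rewrite /prod_act !gset_act1. Qed.

Lemma prod_actM t x y : prod_act t (x * y)%g = prod_act (prod_act t x) y.
Proof. by rewrite /prod_act !gset_actM. Qed.

Definition prod_gset : gset G :=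
  @GSet G (T1 * T2)%type prod_act prod_act1 prod_actM.

End Product.

Section TwistedFunctions.
Variables (T : gset G) (A : nzRingType) (xi : T -> G -> A).
Hypotheses (xi1 : forall t, xi t 1%g = 1)
  (xiM : forall t x y, xi t (x * y)%g = xi t x * xi (gset_act t x) y).

Definition twist_act x (f : {ffun T -> A}) : {ffun T -> A} :=
  [ffun t => xi t x * f (gset_act t x)].

Lemma twist_actD x : {morph twist_act x : u v / u + v}.
Proof. by move=> u v; apply/ffunP => t; rewrite !ffunE mulrDr. Qed.

Lemma twist_act1 f : twist_act 1%g f = f.
Proof. by apply/ffunP => t; rewrite !ffunE xi1 mul1r gset_act1. Qed.

Lemma twist_actM x y f : twist_act (x * y)%g f = twist_act x (twist_act y f).
Proof. by apply/ffunP => t; rewrite !ffunE xiM gset_actM mulrA. Qed.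

(** A monomial module: for transitive [T] it is coinduced from the rank one representation that [xi]
    defines on a point stabiliser. *)
Definition twisted_gmod : gmodule G :=
  @GModule G {ffun T -> A} twist_act twist_actD twist_act1 twist_actM.

End TwistedFunctions.

Section Functions.
Variables (T : gset G) (A : nzRingType).

Lemma triv1 (t : T) : (fun (_ : T) (_ : G) => 1 : A) t 1%g = 1.
Proof. by []. Qed.

Lemma trivM (t : T) (x y : G) :
  (fun (_ : T) (_ : G) => 1 : A) t (x * y)%g = 1 * 1.
Proof. by rewrite mulr1. Qed.

Definition fun_gmod : gmodule G := twisted_gmod triv1 trivM.

Lemma fun_gmodE x (f : fun_gmod) t : gmod_act x f t = f (gset_act t x).
Proof. by rewrite ffunE mul1r. Qed.

Lemma cocycle_crossed (c : G -> fun_gmod) :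
  crossed c -> cocycle (fun t x => c x t).
Proof. by move=> cM t x y; rewrite cM ffunE fun_gmodE. Qed.

End Functions.

End GSetTheory.

(** * Division of integral cocycles by a prime *)

Section ModPrime.
Variable p : nat.
Hypothesis p_pr : prime p.

Lemma dvdz_Fp (z : int) : (p %| z)%Z = (z%:~R == 0 :> 'F_p).
Proof. exact/dvdz_pcharf/pchar_Fp. Qed.

Lemma Fp_natK (a : 'F_p) : ((a : nat)%:Z)%:~R = a.
Proof. by rewrite -pmulrn natr_Zp. Qed.

Lemma Fp_mulrn (a : 'F_p) : a *+ p = 0.
Proof. by rewrite -mulr_natr (pcharf0 (pchar_Fp p_pr)) mulr0. Qed.

Variables (G : groupType) (T : gset G) (lam : T -> G -> int) (u : T -> 'F_p).
Hypothesis lamM : cocycle lam.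
Hypothesis lam_u : forall t x, u (gset_act t x) = u t + (lam t x)%:~R.

(* If lam is the coboundary of u modulo p, this is (lam - du~)/p for a lift u~
   of u. *)
Definition divided t x : int :=
  ((lam t x - ((u (gset_act t x) : nat)%:Z - (u t : nat)%:Z)) %/ p)%Z.

Lemma dividedE t x :
  p%:Z * divided t x = lam t x - ((u (gset_act t x) : nat)%:Z - (u t : nat)%:Z).
Proof.
rewrite mulrC divzK // dvdz_Fp !rmorphB /= !Fp_natK lam_u.
by rewrite [u t + _]addrC addrK subrr.
Qed.

Lemma divided_cocycle : cocycle divided.
Proof.
have p0 : p%:Z != 0 by rewrite eqz_nat -lt0n prime_gt0.
move=> t x y; apply: (mulfI p0).
rewrite mulrDr !dividedE lamM gset_actM addrACA -opprD; congr (_ - _).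
by rewrite [RHS]addrC subrKA.
Qed.

Lemma divided_fix t x : gset_act t x = t -> p%:Z * divided t x = lam t x.
Proof. by move=> tx; rewrite dividedE tx subrr subr0. Qed.

End ModPrime.

Lemma sum_Fp (A : zmodType) (p : nat) (F : 'F_p -> A) : prime p ->
  \sum_(i < p) F i%:R = \sum_u F u.
Proof.
move=> p_pr; rewrite -[RHS](eq_bigr _ (fun u _ => congr1 F (natr_Zp u))).
by rewrite -!(big_mkord xpredT (fun i => F i%:R)) Fp_cast.
Qed.

Section MoreGSets.
Variable G : groupType.
Implicit Types T : gset G.

Lemma ext_fixes T (V : finZmodType) (c : T -> G -> V) (cM : cocycle c) x :
  fixes T x -> (forall t, c t x = 0) -> fixes (ext_gset cM) x.
Proof.
by move=> Tx cx [t v]; rewrite /gset_act /= /ext_act /= Tx cx addr0.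
Qed.

Lemma loop_conj T (t s : T) (x z : G) (A : zmodType) (c : T -> G -> A) :
  cocycle c -> gset_act t x = s -> gset_act t z = t ->
  gset_act s (x^-1 * z * x)%g = s /\ c s (x^-1 * z * x)%g = c t z.
Proof.
move=> cM tx tz; have sx : gset_act s x^-1%g = t by rewrite -tx gset_actK.
rewrite !gset_actM sx tz tx; split=> //.
by rewrite !cM gset_actM sx tz (cocycleV cM) sx addrAC addNr add0r.
Qed.

(** Division by [p] is undone by the [p]-th power: as [x] fixes [pi t], the cocycle [lam] takes the
    value [p * lam (pi t) x] on [x ^+ p]. *)
Lemma divided_pow (p : nat) T T' (pi : T' -> T) (lam : T -> G -> int)
    (u : T' -> 'F_p) t x : prime p -> cocycle lam ->
  gset_act (pi t) x = pi t -> gset_act t (x ^+ p)%g = t ->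
  (forall t x, u (gset_act t x) = u t + (lam (pi t) x)%:~R) ->
  divided (fun t => lam (pi t)) u t (x ^+ p)%g = lam (pi t) x.
Proof.
move=> p_pr lamM ptx txp lam_u.
have p0 : p%:Z != 0 by rewrite eqz_nat -lt0n prime_gt0.
apply: (mulfI p0); rewrite divided_fix // cocycleX_fix //.
by rewrite -mulr_natl natz.
Qed.

End MoreGSets.

(** * Integral and mod p cocycles of surface groups *)

Section SurfaceLifting.
Variables g n : nat.
Local Notation G := (pi1_surface g n).

(** An invariant functional forgets the action, and without punctures each generator occurs in the
    relator once with each sign, so the contributions cancel. *)
Lemma ev_relator_inv (M : gmodule G) (A : zmodType) (s : M -> A)
    (d : surface_gen g n -> M) :
  n = 0%N -> {morph s : a b / a + b} -> (forall x m, s (gmod_act x m) = s m) ->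
  s (ev d (surface_relator g n)) = 0.
Proof.
move=> n0 sD sA; have s0 : s 0 = 0.
  have /(congr1 (fun m => m - s 0)) := sD 0 0.
  by rewrite addr0 subrr addrK.
have sN m : s (- m) = - s m by apply/eqP; rewrite -addr_eq0 -sD addNr s0.
have s_cat u v : s (ev d (u ++ v)) = s (ev d u) + s (ev d v).
  by rewrite ev_cat sD sA.
rewrite (congr1 (ev _) (surface_relatorE g n)) s_cat.
have -> : punctures g n = [::].
  by apply/size0nil; rewrite size_map size_enum_ord.
rewrite [s (ev d [::])]s0 addr0; elim: (enum 'I_g) => [//|i r IHr].
rewrite /handles map_cons /= -/(handles n r) !(sD, sA) IHr addr0.
rewrite /ev_letter /= !(sN, sA).
by rewrite addrA -opprD subrr.
Qed.

(** If the obstruction of a lift [d] is the coboundary of a cochain in [N], subtracting that cochain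
    gives a crossed homomorphism with the same image modulo [N]. *)
Lemma crossed_correct (M : gmodule G) (N : M -> Prop)
    (d : surface_gen g n -> M) :
  relator_value N (ev d (surface_relator g n)) ->
  exists2 c : G -> M, crossed c &
    forall y, exists2 m, N m & c (pgen _ y) = d y - m.
Proof.
move=> [d' Nd' dd'].
have [r|c cM cE] := @crossed_of_ev _ [:: surface_relator g n] M (fun y => d y - d' y).
  by rewrite inE => /eqP ->; rewrite evD evN dd' subrr.
exists c => // y; exists (d' y) => //.
by rewrite cE ev_pgen.
Qed.

Section BaseCocycles.
Variables (Q : finGroupType) (theta : G -> Q).
Hypothesis thetaM : {morph theta : x y / (x * y)%g}.

Lemma morph_one : theta 1%g = 1%g.
Proof. by apply: (mulgI (theta 1%g)); rewrite -thetaM !mulg1. Qed.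

Definition reg_act (q : Q) (x : G) : Q := (q * theta x)%g.

Lemma reg_act1 q : reg_act q 1%g = q.
Proof. by rewrite /reg_act morph_one mulg1. Qed.

Lemma reg_actM q x y : reg_act q (x * y)%g = reg_act (reg_act q x) y.
Proof. by rewrite /reg_act thetaM mulgA. Qed.

Definition regular_gset : gset G := @GSet G Q reg_act reg_act1 reg_actM.

(** [k t] is the exponent of [c] that leads to [t] from the chosen representative of its coset
    [<[c]> t], read modulo [p]. *)
Lemma cyclic_log (p : nat) (c : Q) : prime p -> #[c]%g = p ->
  exists k : Q -> 'F_p, forall t, k (c * t)%g = k t + 1.
Proof.
move=> p_pr oc; pose r t := repr (<[c]> :* t)%g.
pose i t := [pick i : 'I_p | (c ^+ i * r t)%g == t].
have rK t : exists2 j : 'I_p, i t = Some j & (c ^+ j * r t)%g = t.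
  rewrite /i; case: pickP => [j /eqP jt|none]; first by exists j.
  have /rcosetP[h /cycleP[j ->] rt] : r t \in (<[c]> :* t)%g.
    exact/mem_repr/rcoset_refl.
  have : (c ^- j * r t = t)%g by rewrite rt mulKg.
  have /cyclePmin[l + ->] : (c ^- j \in <[c]>)%g by rewrite groupV mem_cycle.
  by rewrite oc => lp lt; have := none (Ordinal lp); rewrite /= lt eqxx.
(* The default 0 is never taken, by [rK]. *)
exists (fun t => if i t is Some j then (j : nat)%:R else 0) => t.
have [j -> jt] := rK t; have [l -> lt] := rK (c * t)%g.
have rc : r (c * t)%g = r t by rewrite /r rcosetM rcoset_id ?cycle_id.
have : (c ^+ l)%g = (c ^+ j.+1)%g.
  by apply: (mulIg (r t)); rewrite expgS -mulgA jt -{1}rc lt.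
move/eqP; rewrite eq_expg_mod_order oc => /eqP lj.
by rewrite natr1 -(Fp_nat_mod p_pr l) lj Fp_nat_mod //.
Qed.

Hypothesis theta_surj : forall q : Q, exists x, theta x = q.

(* For C = <[c]>, the class of C\Q given by the logarithm on C lifts to an
   integral class, as H^2 has no torsion. On Q the lift becomes divisible by p up
   to a coboundary, and its quotient by p detects x ^+ p. *)
Lemma base_cocycle (p : nat) (c : Q) : prime p -> #[c]%g = p ->
  exists2 lam : regular_gset -> G -> int, cocycle lam &
    forall (t : Q) x, (t * theta x = c * t)%g -> ~~ (p %| lam t (x ^+ p)%g)%Z.
Proof.
move=> p_pr oc; have [k kc] := cyclic_log p_pr oc.
have p0 : p%:Z != 0 by rewrite eqz_nat -lt0n prime_gt0.
pose M := fun_gmod regular_gset int.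
pose Mp := fun_gmod regular_gset 'F_p.
(* [N] consists of the functions on the quotient of [Q] by [C]; although [k] is not in it, the
   coboundary [dk] of [k] is invariant under [c]. *)
pose N (f : M) := forall t : Q, f (c * t)%g = f t.
have N0 : N 0 by move=> t; rewrite !ffunE.
have ND u v : N u -> N v -> N (u + v).
  by move=> Nu Nv t; rewrite !ffunE Nu Nv.
have NN u : N u -> N (- u) by move=> Nu t; rewrite !ffunE Nu.
have NA x u : N u -> N (gmod_act x u).
  by move=> Nu t; rewrite !fun_gmodE -[RHS]Nu /gset_act /= /reg_act mulgA.
pose red (f : M) : Mp := [ffun t => (f t)%:~R].
have redD : {morph red : a b / a + b}.
  by move=> a b; apply/ffunP => t; rewrite !ffunE rmorphD.
have redA x m : red (gmod_act x m) = gmod_act x (red m).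
  by apply/ffunP => t; rewrite ffunE !fun_gmodE ffunE.
pose dk (x : G) : Mp := [ffun t : Q => k (t * theta x)%g - k t].
have dkM : crossed dk.
  move=> x y; apply/ffunP => t; rewrite 2!ffunE fun_gmodE ffunE /gset_act /= /reg_act.
  by rewrite thetaM mulgA ffunE [RHS]addrC subrKA.
pose d0 (y : surface_gen g n) : M := [ffun t => (dk (pgen _ y) t : nat)%:Z].
have Nd0 y : N (d0 y).
  move=> t; rewrite !ffunE -mulgA !kc; congr (nat_of_ord _)%:Z.
  by rewrite opprD addrACA subrr addr0.
have red_d0 y : red (d0 y) = dk (pgen _ y).
  by apply/ffunP => t; rewrite 2!ffunE Fp_natK.
pose D := ev d0 (surface_relator g n).
have ND' : N D by apply: (ev_closed N0 ND NN NA).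
have red_D : red D = 0.
  rewrite /D (ev_map _ _ redD redA).
  have -> : red \o d0 = dk \o pgen [:: surface_relator g n].
    by apply/funext => y; apply: red_d0.
  rewrite -crossed_ev // of_word_rel ?mem_head //; apply/ffunP => t.
  by rewrite !ffunE morph_one mulg1 subrr.
pose D' : M := [ffun t => (D t %/ p)%Z].
have DE t : D t = p%:Z * D' t.
  rewrite ffunE mulrC divzK // dvdz_Fp //.
  by have /ffunP/(_ t) := red_D; rewrite !ffunE => ->.
have ND'' : N D' by move=> t; rewrite !ffunE ND'.
(* Once [D'] is a coboundary, [D] is the coboundary of a multiple of [p], so that [d0] can be
   corrected without changing its reduction. *)
have rvD' : relator_value N D'.
  have [n0|n_gt0] := posnP n; last exact: relator_value_puncture.
  pose C := <[c]>%g; pose r t := repr (C :* t)%g.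
  have rC t : r t \in (C :* t)%g by exact/mem_repr/rcoset_refl.
  have NC (f : M) h t : N f -> h \in C -> f (h * t)%g = f t.
    move=> Nf /cycleP[j ->]; elim: j => [|j IHj]; first by rewrite mul1g.
    by rewrite expgS -mulgA Nf.
  have rE s t : s \in (C :* t)%g -> r s = r t.
    by move=> /rcoset_eqP st; rewrite /r st.
  have Nr (f : M) t : N f -> f (r t) = f t.
    by move=> Nf; have /rcosetP[h hC ->] := rC t; rewrite NC.
  (* [D] sums to 0 over [Q] and is constant on cosets of [C], which have [p] elements each; hence
     [D'] sums to 0 over the coset representatives, the fixed points of [r]. *)
  have sumD : \sum_(t | r t == t) D' t = 0.
    apply: (mulfI p0); rewrite mulr0 mulr_sumr.
    have sumD : \sum_t D t = 0.
      apply: (@ev_relator_inv M int (fun f => \sum_t f t) d0 n0).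
        by move=> a b; rewrite -big_split; apply: eq_bigr => t _; rewrite ffunE.
      move=> x m; rewrite [RHS](reindex_inj (@gset_act_inj G regular_gset x)).
      by apply: eq_bigr => t _; rewrite fun_gmodE.
    move: sumD; rewrite (eq_bigr _ (fun t _ => DE t)).
    rewrite -[X in X = 0 -> _]mulr_sumr => /eqP; rewrite mulf_eq0 (negbTE p0) /=.
    rewrite (partition_big r (fun t => r t == t)) => [/eqP sumD'|t _].
      rewrite -[RHS]sumD'; apply: eq_bigr => t /eqP rt.
      rewrite (eq_bigl (fun s => s \in (C :* t)%g)) => [|s]; last first.
        apply/eqP/idP => [<-|/rE -> //].
        by rewrite rcoset_sym; apply: rC.
      rewrite (eq_bigr (fun=> D' t)) => [|s]; last first.
        by move=> /rE; rewrite rt => <-; rewrite Nr.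
      by rewrite sumr_const card_rcoset -[#|C|]/(#[c]%g) oc -mulr_natl natz.
    by apply/eqP/rE/rC.
  (* Each value [D' t] is placed on the coset [C] itself; [y t] moves it to [C t]. The sum of the
     [m t] vanishes by [sumD], so [D'] is a sum of differences covered by duality. *)
  pose m (t : Q) : M := [ffun s : Q => if s \in C then D' t else 0].
  have Nm t : N (m t) by move=> s; rewrite !ffunE groupMl ?cycle_id.
  have invQ (t : Q) : exists x, theta x = t^-1%g by apply: theta_surj.
  have [y yE] := boolp.choice invQ.
  have -> : D' = \sum_(t | r t == t) (gmod_act (y t) (m t) - m t).
    rewrite sumrB; apply/ffunP => s; rewrite !ffunE !sum_ffunE.
    have -> : \sum_(t | r t == t) m t s = 0.
      rewrite (eq_bigr (fun t => if s \in C then D' t else 0)) => [|t _].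
        by case: (s \in C); rewrite ?sumD ?big1_eq.
      by rewrite ffunE.
    rewrite subr0 (bigD1 (r s)) /=; last exact/eqP/rE/rC.
    rewrite (@fun_gmodE G regular_gset int) ffunE /gset_act /= /reg_act yE.
    rewrite -mem_rcoset rcoset_sym rC.
    rewrite big1 => [|t /andP[/eqP rt nt]]; first by rewrite addr0 Nr // ffunE.
    rewrite (@fun_gmodE G regular_gset int) ffunE /gset_act /= /reg_act yE -mem_rcoset.
    by case: ifP => // /rE rst; rewrite -rt -rst eqxx in nt.
  by apply: relator_value_sum => // t _; apply: relator_value_aug.
have [|kh khM khE] :=
    @crossed_correct M (fun f => exists2 f', N f' & f = [ffun t => p%:Z * f' t]) d0.
  have [d' Nd' dd'] := rvD'.
  exists (fun x => [ffun t => p%:Z * d' x t]) => [x|]; first by exists (d' x).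
  pose h (f : M) : M := [ffun t => p%:Z * f t].
  have := @ev_map _ _ M M h d' (surface_relator g n).
  rewrite dd' => <-.
  - by apply/ffunP => t; rewrite ffunE -DE.
  - by move=> a b; apply/ffunP => t; rewrite !ffunE mulrDr.
  - by move=> x f; apply/ffunP => t; rewrite ffunE !fun_gmodE ffunE.
have Nkh x : N (kh x).
  apply: (crossed_closed N0 ND NN NA) khM _ => y.
  have [f [f' Nf' ->] ->] := khE y; apply: ND; first exact: Nd0.
  by apply: NN => t; rewrite !ffunE Nf'.
have red_kh x : red (kh x) = dk x.
  apply: (crossed_eq (crossed_map redD redA khM) dkM) => y /=.
  have [f [f' Nf' ->] ->] := khE y; rewrite -red_d0.
  apply/ffunP => t; rewrite !ffunE rmorphB rmorphM /=.
  by rewrite -[p%:~R]/(p%:R) pcharf0 ?pchar_Fp // mul0r subr0.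
have kh_cocycle : cocycle (fun (t : regular_gset) x => kh x t).
  exact: cocycle_crossed.
have kh_k (t : regular_gset) x : k (gset_act t x) = k t + (kh x t)%:~R.
  have /ffunP/(_ t) := red_kh x; rewrite !ffunE => ->.
  by rewrite addrC subrK.
exists (divided (fun t x => kh x t) k); first exact: divided_cocycle.
move=> t x tx.
have txi i : gset_act (t : regular_gset) (x ^+ i)%g = (c ^+ i * t)%g.
  elim: i => [|i IHi]; first by rewrite gset_act1 mul1g.
  by rewrite expgSr gset_actM IHi /gset_act /= /reg_act -mulgA tx expgSr mulgA.
have khc i : kh x (c ^+ i * t)%g = kh x t.
  elim: i => [|i IHi]; first by rewrite mul1g.
  by rewrite expgS -mulgA Nkh.
(* The powers of [x] move [t] along its coset, on which [kh x] is constant, so the value at [x ^+ p]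
   is [p * kh x t]. Modulo [p], [kh x t] is [k (c * t) - k t = 1]. *)
have -> : divided (fun t x => kh x t) k t (x ^+ p)%g = kh x t.
  apply: (mulfI p0); rewrite divided_fix //; last first.
    by rewrite txi -oc expg_order mul1g.
  rewrite (cocycleX kh_cocycle) (eq_bigr (fun=> kh x t)) => [|i _].
    by rewrite sumr_const card_ord -mulr_natl natz.
  by rewrite txi khc.
rewrite dvdz_Fp //; have /ffunP/(_ t) := red_kh x; rewrite !ffunE => ->.
by rewrite tx kc addrAC subrr add0r oner_eq0.
Qed.

End BaseCocycles.
End SurfaceLifting.

(** * Lifting classes through the transfer *)

Section Transfer.
Variables g n : nat.
Local Notation G := (pi1_surface g n).
Variables (p : nat) (J : gset G).
Variables (psi a0 : J -> G -> 'F_p) (a1 : J -> G -> int).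
Hypotheses (p_pr : prime p) (psiM : cocycle psi) (a0M : cocycle a0)
  (a1M : cocycle a1).

Local Notation Tpsi := (ext_gset psiM).
Local Notation T := (ext_gset (cocycle_pull a0M (@ext_fst_equivariant _ _ _ _ psiM))).

(* The obstruction D to lifting a1 through the transfer is constant along the
   fibres of psi and sums to 0 along those of a0. Its part over j is the sum of the
   z^i m_i, where m_i lives on one sheet of psi and is the translate of D by
   - i a0(j, z) there. The m_i add up to 0, so D is a coboundary by duality. *)
Lemma transfer_cocycle :
  (forall j, exists z, [/\ gset_act j z = j, psi j z != 0 & a0 j z != 0]) ->
  exists2 X : T -> G -> int, cocycle X &
    forall (j : J) (s : 'F_p) x, \sum_(u : 'F_p) X ((j, s), u) x = a1 j x.
Proof.
move=> loops.
pose M := fun_gmod T int; pose M' := fun_gmod Tpsi int.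
pose S (f : M) : M' := [ffun q : J * 'F_p => \sum_(u : 'F_p) f (q, u)].
have SD : {morph S : a b / a + b}.
  move=> a b; apply/ffunP => q; rewrite !ffunE -big_split.
  by apply: eq_bigr => u _; rewrite ffunE.
have SA x m : S (gmod_act x m) = gmod_act x (S m).
  apply/ffunP => q; rewrite ffunE fun_gmodE ffunE.
  rewrite [RHS](reindex_inj (addIr (a0 q.1 x))).
  by apply: eq_bigr => u _; rewrite (@fun_gmodE G T int).
pose c1 (x : G) : M' := [ffun q : J * 'F_p => a1 q.1 x].
have c1M : crossed c1.
  by move=> x y; apply/ffunP => q; rewrite [RHS]ffunE fun_gmodE !ffunE a1M.
have S0 : S 0 = 0.
  by apply/ffunP => q; rewrite !ffunE big1 // => u _; rewrite ffunE.
have SN m : S (- m) = - S m.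
  by apply/eqP; rewrite -addr_eq0 -SD addNr S0.
pose N (f : M) := S f = 0.
have N0 : N 0 by [].
have ND u v : N u -> N v -> N (u + v) by rewrite /N SD => -> ->; rewrite addr0.
have NN u : N u -> N (- u) by rewrite /N SN => ->; rewrite oppr0.
have NA x u : N u -> N (gmod_act x u) by rewrite /N SA => ->; rewrite gmod_act0.
(* On generators, [a1] is lifted by placing it on the sheet 0 of each fibre of [a0]. This does not
   depend on the coordinate of [psi], which makes [D] constant along it. *)
pose d0 (y : surface_gen g n) : M :=
  [ffun q : J * 'F_p * 'F_p => if q.2 == 0 then a1 q.1.1 (pgen _ y) else 0].
have Sd0 y : S (d0 y) = c1 (pgen _ y).
  apply/ffunP => q; rewrite !ffunE (bigD1 0) //= ffunE eqxx.
  by rewrite big1 ?addr0 // => u /negbTE u0; rewrite ffunE /= u0.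
pose D := ev d0 (surface_relator g n).
have NDD : N D.
  rewrite /N /D (ev_map _ _ SD SA).
  have -> : S \o d0 = c1 \o pgen [:: surface_relator g n].
    by apply/funext => y; apply: Sd0.
  rewrite -crossed_ev // of_word_rel ?mem_head //; apply/ffunP => q.
  by rewrite !ffunE cocycle1.
pose N' (f : M) := forall j s u, f ((j, s), u) = f ((j, 0), u).
have N'D : N' D.
  apply: (ev_closed (N := N')).
  - by move=> j s u; rewrite !ffunE.
  - by move=> f f' Nf Nf' j s u; rewrite !ffunE Nf Nf'.
  - by move=> f Nf j s u; rewrite !ffunE Nf.
  - move=> x f Nf j s u; rewrite !(@fun_gmodE G T int) /gset_act /= /ext_act /=.
    by rewrite Nf [in RHS]Nf.
  - by move=> y j s u; rewrite !ffunE.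
have rvD : relator_value N D.
  have -> : D = \sum_(j : J)
      [ffun q : J * 'F_p * 'F_p => if q.1.1 == j then D q else 0].
    apply/ffunP => q; rewrite sum_ffunE (bigD1 q.1.1) //= ffunE eqxx.
    rewrite big1 ?addr0 // => j /negbTE qj; by rewrite ffunE eq_sym qj.
  apply: relator_value_sum => // j _.
  have [z [jz psiz a0z]] := loops j.
  have jzi (i : nat) : gset_act j (z ^+ i)%g = j by apply: gset_actX_fix.
  set E := [ffun _ => _].
  pose m (i : 'F_p) : M := [ffun q : J * 'F_p * 'F_p =>
    if (q.1.1 == j) && (q.1.2 == 0) then D ((j, 0), q.2 - i * a0 j z) else 0].
  have Nm i : N (m i).
    apply/ffunP => -[j' s]; rewrite !ffunE /=.
    have [jj|nj] := boolP ((j' == j) && (s == 0)); last first.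
      by rewrite big1 // => u _; rewrite ffunE /= (negbTE nj).
    rewrite (eq_bigr (fun u => D ((j, 0), u - i * a0 j z))) => [|u _]; last first.
      by rewrite ffunE /= jj.
    rewrite (reindex_inj (addIr (i * a0 j z))) /=.
    have /ffunP/(_ (j, 0)) := NDD; rewrite !ffunE /= => {2}<-.
    by apply: eq_bigr => u _; rewrite addrK.
  have -> : E = \sum_(i : 'F_p) (gmod_act (z ^+ i)%g (m i) - m i).
    rewrite sumrB.
    have -> : \sum_(i : 'F_p) m i = 0.
      apply/ffunP => -[[j' s] u]; rewrite sum_ffunE ffunE.
      rewrite (eq_bigr (fun i => if (j' == j) && (s == 0)
        then D ((j, 0), u - i * a0 j z) else 0)) => [|i _]; last by rewrite ffunE.
      case: (_ && _); last by rewrite big1_eq.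
      have inj : injective (fun i : 'F_p => u - i * a0 j z).
        by move=> i i' /addrI/oppr_inj/(mulIf a0z).
      have /ffunP/(_ (j, 0)) := NDD; rewrite !ffunE /= => {2}<-.
      by rewrite [RHS](reindex_inj inj).
    rewrite subr0; apply/ffunP => -[[j' s] u]; rewrite sum_ffunE [LHS]ffunE.
    have mulE (i b : 'F_p) : b *+ i = i * b by rewrite -[in RHS](natr_Zp i) mulr_natl.
    have actE (i : 'F_p) : gmod_act (z ^+ i)%g (m i) ((j', s), u) =
        if (j' == j) && (s + i * psi j z == 0) then D ((j, 0), u) else 0.
      rewrite (@fun_gmodE G T int) ffunE /gset_act /= /ext_act /=.
      rewrite -{1}(jzi i) (inj_eq (@gset_act_inj _ J (z ^+ i)%g)).
      have [->|//] := eqVneq j' j; rewrite !cocycleX_fix //=.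
      by rewrite !mulE addrK.
    rewrite (eq_bigr _ (fun i _ => actE i)).
    rewrite [_.1.1]/=; have [->|nj] := eqVneq j' j; last by rewrite big1_eq.
    (* As [psi j z] is nonzero, exactly one power [i] brings the sheet [s] to the sheet 0 that
       carries [m i]. *)
    rewrite -big_mkcond (big_pred1 (- s / psi j z)) => [|i] /=; last first.
      by rewrite addrC addr_eq0 -(can_eq (mulfK psiz) i) divfK.
    exact: N'D.
  by apply: relator_value_sum => // i _; apply: relator_value_aug.
have [c cM cE] := crossed_correct rvD.
have Sc : S \o c =1 c1.
  apply: crossed_eq (crossed_map SD SA cM) c1M _ => y /=.
  by have [m Nm ->] := cE y; rewrite SD SN Nm oppr0 addr0 Sd0.
exists (fun t x => c x t); first exact: cocycle_crossed.
by move=> j s x; have /ffunP/(_ (j, s)) := Sc x; rewrite !ffunE.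
Qed.

End Transfer.

(** * Dimension counts for crossed homomorphisms *)

Lemma linear_system_kernel (F : fieldType) (I J : finType)
    (f : {ffun I -> F} -> J -> F) :
  (forall u v j, f (u + v) j = f u j + f v j) ->
  (forall a (u : {ffun I -> F}) j, f [ffun i => a * u i] j = a * f u j) ->
  (#|J| < #|I|)%N -> exists2 u, u != 0 & forall j, f u j = 0.
Proof.
move=> fD fZ JI; pose delta i0 : {ffun I -> F} := [ffun i => (i == i0)%:R].
pose A := \matrix_(i < #|I|, j < #|J|) f (delta (enum_val i)) (enum_val j).
have : kermx A != 0.
  rewrite -mxrank_eq0 mxrank_ker subn_eq0 -ltnNge.
  exact: leq_ltn_trans (rank_leq_col _) JI.
case/rowV0Pn=> v /sub_kermxP vA v0; exists [ffun i => v 0 (enum_rank i)].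
  apply: contra v0 => /eqP/ffunP u0; apply/eqP/rowP => i.
  by have := u0 (enum_val i); rewrite !ffunE enum_valK mxE.
have f0 j : f 0 j = 0.
  by have /(congr1 (fun m => m - f 0 j)) := fD 0 0 j; rewrite addr0 subrr addrK.
move=> j; have -> : [ffun i => v 0 (enum_rank i)] =
    \sum_(k < #|I|) [ffun i => v 0 k * delta (enum_val k) i].
  apply/ffunP => i; rewrite sum_ffunE (bigD1 (enum_rank i)) //= !ffunE.
  rewrite enum_rankK eqxx mulr1 big1 ?addr0 // => k ki.
  rewrite !ffunE; case: eqP => [ik|]; last by rewrite mulr0.
  by rewrite ik enum_valK eqxx in ki.
rewrite (big_morph (f^~ j) (fun u v => fD u v j) (f0 j)).
have /rowP/(_ (enum_rank j)) := vA; rewrite !mxE; apply: etrans.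
by apply: eq_bigr => k _; rewrite fZ mxE enum_rankK.
Qed.

Section DimensionCount.
Variables g n : nat.
Local Notation G := (pi1_surface g n).

(* There are 2 g + n generators and one relator, hence at least 2 g + n - 1 times
   #|T| independent crossed homomorphisms. *)
Lemma crossed_exists (F : fieldType) (T : gset G) (xi : T -> G -> F)
    (xi1 : forall t, xi t 1%g = 1)
    (xiM : forall t x y, xi t (x * y)%g = xi t x * xi (gset_act t x) y)
    (I : finType) (y : I -> G) (s : I -> T) :
  (#|T| + #|I| < (2 * g + n) * #|T|)%N ->
  exists2 c : G -> twisted_gmod xi1 xiM, crossed c &
    (exists x, c x != 0) /\ forall i, c (y i) (s i) = 0.
Proof.
move=> cardT; pose M := twisted_gmod xi1 xiM.
pose X : finType := ('I_g + 'I_g + 'I_n)%type.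
pose d (e : {ffun X * T -> F}) (x : surface_gen g n) : M :=
  [ffun t => e (x : X, t)].
have hw i : exists w, y i = of_word [:: surface_relator g n] w.
  by have [w ->] := of_word_repr (y i); exists w.
have [w wE] := boolp.choice hw.
(* The unknowns are the coordinates of the values on generators. The equations ask that the relator
   evaluate to 0, once for each point of [T], and that the prescribed coordinates vanish. *)
pose f e (j : T + I) : F :=
  match j with
  | inl t => ev (d e) (surface_relator g n) t
  | inr i => ev (d e) (w i) (s i)
  end.
have fD u v j : f (u + v) j = f u j + f v j.
  have dD : d (u + v) = fun x => d u x + d v x.
    by apply/funext => x; apply/ffunP => t; rewrite !ffunE.
  by case: j => [t|i]; rewrite /f dD evD ffunE.
have fZ a (u : {ffun X * T -> F}) j : f [ffun q => a * u q] j = a * f u j.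
  pose h (m : M) : M := [ffun t => a * m t].
  have hE u' : ev (d [ffun q => a * u q]) u' = h (ev (d u) u').
    rewrite (@ev_map _ _ M M).
    - congr (ev _ _); apply/funext => x.
      by apply/ffunP => t; rewrite !ffunE.
    - by move=> m m'; apply/ffunP => t; rewrite !ffunE mulrDr.
    - by move=> x m; apply/ffunP => t; rewrite !ffunE mulrCA.
  by case: j => [t|i]; rewrite /f hE ffunE.
have [|e e0 fe] := linear_system_kernel fD fZ.
  rewrite card_sum card_prod !card_sum !card_ord.
  by rewrite addnn -mul2n.
have [r|c cM cE] := @crossed_of_ev _ [:: surface_relator g n] M (d e).
  by rewrite inE => /eqP ->; apply/ffunP => t; have := fe (inl t); rewrite /f ffunE.
exists c => //; split; last by move=> i; rewrite wE cE; apply: (fe (inr i)).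
apply: contrapT => c0; case/eqP: e0; apply/ffunP => -[x t]; rewrite ffunE.
have : c (pgen _ x) = 0.
  by apply/eqP; apply: contrapT => cx; apply: c0; exists (pgen _ x); apply/negP.
rewrite cE ev_pgen => /ffunP/(_ t).
by rewrite !ffunE.
Qed.

(** The count gives a nonzero [psi] vanishing on paths [P t] from a base point and on two pivot
    loops, [k0] for [l0] and [k1] for [l1] on the loops killed by [l0]. If [psi] vanished on all
    loops killed by both, correcting any loop by powers of the pivots would make it vanish on all
    loops, hence everywhere. *)
Lemma independent_cocycle (p : nat) (T : gset G) (l0 l1 : T -> G -> 'F_p) :
  (1 < g)%N -> prime p -> transitive_gset T -> (1 < #|T|)%N ->
  cocycle l0 -> cocycle l1 ->
  exists2 psi : T -> G -> 'F_p, cocycle psi & forall t, exists z,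
    [/\ gset_act t z = t, l0 t z = 0, l1 t z = 0 & psi t z != 0].
Proof.
move=> g_gt1 p_pr Ttrans T_gt1 l0M l1M.
have [t0 _] : exists t0 : T, t0 \in T by apply/card_gt0P/ltnW.
(* The pivot is a loop in [P] on which [l] is nonzero, if there is one, and 1 otherwise. *)
have loop_pivot (l : T -> G -> 'F_p) (P : G -> Prop) :
    exists2 k, gset_act t0 k = t0 /\ (k = 1%g \/ P k) &
      l t0 k = 0 -> forall z, gset_act t0 z = t0 -> P z -> l t0 z = 0.
  have [[k [kt Pk lk]]|none] :=
      pselect (exists k, [/\ gset_act t0 k = t0, P k & l t0 k != 0]).
    by exists k; [split=> //; right | move/eqP: lk].
  exists 1%g; first by rewrite gset_act1; split=> //; left.
  move=> _ z zt Pz; apply/eqP; apply: contrapT => lz; apply: none.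
  by exists z; split=> //; apply/negP.
have [k0 [k0t _] k0P] := loop_pivot l0 (fun=> True).
have [k1 [k1t k1P'] k1P] := loop_pivot l1 (fun z => l0 t0 z = 0).
have l0k1 : l0 t0 k1 = 0 by case: k1P' => [->|//]; rewrite cocycle1.
have [P PE] := boolp.choice (Ttrans t0).
have tP t : gset_act t (P t)^-1%g = t0 by rewrite -{1}(PE t) gset_actK.
pose I := option (option T).
pose y (i : I) := match i with None => k0 | Some None => k1 | Some (Some t) => P t end.
(* There are [#|T| + 2] extra conditions, and [2 * #|T| + 2 < 4 * #|T|] since [T] has more than one
   point. *)
have [|c cM [[x cx] c0]] :=
  @crossed_exists 'F_p T _ (@triv1 _ T _) (@trivM _ T _) I y (fun=> t0).
  have g4 : (4 <= 2 * g + n)%N by lia.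
  have := leq_mul g4 (leqnn #|T|); rewrite !card_option; lia.
have psiM := cocycle_crossed cM; exists (fun t x => c x t) => //.
pose psi (t : T) (x : G) : 'F_p := c x t; rewrite -/psi in psiM *.
have psi_k0 : psi t0 k0 = 0 := c0 None.
have psi_k1 : psi t0 k1 = 0 := c0 (Some None).
have psi_P t : psi t0 (P t) = 0 := c0 (Some (Some t)).
have pivot (l : T -> G -> 'F_p) k z : cocycle l -> gset_act t0 k = t0 ->
    gset_act t0 z = t0 -> l t0 k != 0 ->
    exists2 a : nat, gset_act t0 (z * k ^+ a)%g = t0 & l t0 (z * k ^+ a)%g = 0.
  move=> lM kt zt lk; exists (- l t0 z / l t0 k : 'F_p).
    by rewrite gset_actM zt gset_actX_fix.
  by rewrite lM zt cocycleX_fix // -mulr_natl natr_Zp divfK // subrr.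
have [z [zt l0z l1z psiz]] : exists z,
    [/\ gset_act t0 z = t0, l0 t0 z = 0, l1 t0 z = 0 & psi t0 z != 0].
  apply: contrapT => none; case/eqP: cx.
  have psi_l01 z : gset_act t0 z = t0 -> l0 t0 z = 0 -> l1 t0 z = 0 -> psi t0 z = 0.
    move=> zt l0z l1z; apply/eqP; apply: contrapT => psiz; apply: none.
    by exists z; split=> //; apply/negP.
  have psi_l0 z : gset_act t0 z = t0 -> l0 t0 z = 0 -> psi t0 z = 0.
    move=> zt l0z; have [l1k|l1k] := eqVneq (l1 t0 k1) 0.
      by apply: psi_l01 => //; apply: k1P.
    have [a zat l1za] := pivot _ _ _ l1M k1t zt l1k.
    have := psi_l01 _ zat; rewrite l1za l0M psiM zt !cocycleX_fix //.
    rewrite l0z l0k1 psi_k1 !mul0rn !addr0.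
    by apply.
  have psi_loop z : gset_act t0 z = t0 -> psi t0 z = 0.
    move=> zt; have [l0k|l0k] := eqVneq (l0 t0 k0) 0.
      by apply: psi_l0 => //; apply: k0P.
    have [a zat l0za] := pivot _ _ _ l0M k0t zt l0k.
    have := psi_l0 _ zat l0za; rewrite psiM zt cocycleX_fix //.
    by rewrite psi_k0 mul0rn addr0.
  apply/ffunP => t; rewrite [RHS]ffunE.
  have := psi_loop (P t * x * (P (gset_act t x))^-1)%g.
  rewrite !gset_actM PE tP => /(_ erefl).
  rewrite !psiM !gset_actM PE psi_P add0r (cocycleV psiM).
  by rewrite tP psi_P oppr0 addr0.
move=> t; exists ((P t)^-1 * z * P t)%g.
have conjE (l : T -> G -> 'F_p) : cocycle l ->
    l t ((P t)^-1 * z * P t)%g = l t0 z.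
  move=> lM; rewrite !lM gset_actM tP zt (cocycleV lM) tP.
  by rewrite addrAC addNr add0r.
by rewrite -[c _ t]/(psi t _) !conjE // !gset_actM tP zt PE.
Qed.

End DimensionCount.

(** * Detecting the elements of prime order *)

Section Merge.
Variables g n p : nat.
Local Notation G := (pi1_surface g n).
Hypotheses (g_gt1 : (1 < g)%N) (p_pr : prime p).

Local Notation modp z := (z%:~R : 'F_p).

(* After dividing lam0 and lam1 by p on a p-cover, where y ^+ p acts trivially,
   let X be a cocycle on the cover of the divided lam0 with transfer the divided
   lam1. Then X takes on p-th powers the value lam1 where lam0 is nonzero modulo
   p, and 0 elsewhere, so lam0 + lam1 - X is lam0 if that is nonzero, and lam1
   otherwise. *)
Lemma merge_two (T : gset G) (lam0 lam1 : T -> G -> int) (r : nat)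
    (lam : 'I_r -> T -> G -> int) :
  transitive_gset T -> (1 < #|T|)%N ->
  cocycle lam0 -> cocycle lam1 -> (forall i, cocycle (lam i)) ->
  (exists t, exists2 v, gset_act t v = t & modp (lam0 t v) != 0) ->
  exists (T' : gset G) (pi : T' -> T) (mu0 : T' -> G -> int)
    (mu : 'I_r -> T' -> G -> int),
  [/\ transitive_gset T', (1 < #|T'|)%N & equivariant pi] /\
  [/\ cocycle mu0, forall i, cocycle (mu i) &
    forall y, fixes T y -> fixes T' (y ^+ (p ^ 2))%g /\ forall t,
      (modp (lam0 (pi t) y) != 0 \/ modp (lam1 (pi t) y) != 0 ->
        modp (mu0 t (y ^+ (p ^ 2))%g) != 0) /\
      forall i, mu i t (y ^+ (p ^ 2))%g = lam i (pi t) y].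
Proof.
move=> Ttrans T_gt1 lam0M lam1M lamM [t1 [v1 t1v1 lam0v1]].
have modpM (T0 : gset G) (c : T0 -> G -> int) :
    cocycle c -> cocycle (fun t x => modp (c t x)).
  by move=> cM t x y; rewrite cM rmorphD.
have l0M := modpM _ _ lam0M; have l1M := modpM _ _ lam1M.
have lM i := modpM _ _ (lamM i).
have [psi psiM psi_loop] := independent_cocycle g_gt1 p_pr Ttrans T_gt1 l0M l1M.
have loops t : exists z (k : int), [/\ gset_act t z = t,
    modp (lam1 t z) = 0, psi t z != 0, lam0 t z = p%:Z * k & modp k != 0].
  have [z [tz /eqP lam0z lam1z psiz]] := psi_loop t.
  have [x t1x] := Ttrans t1 t.
  have [tv lam0v] := loop_conj lam0M t1x t1v1.
  set v := (_ * x)%g in tv lam0v; rewrite -dvdz_Fp // in lam0z.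
  pose k := (lam0 t z %/ p)%Z.
  have lam0zE : lam0 t z = p%:Z * k by rewrite mulrC divzK.
  have [k0|k0] := eqVneq (modp k) 0; last by exists z, k.
  (* Multiplying by [v ^+ p] leaves [psi] and [lam1] unchanged modulo [p], but adds [lam0 t v], a
     unit modulo [p], to the quotient of [lam0] by [p]. *)
  exists (z * v ^+ p)%g, (k + lam0 t v).
  have zv : gset_act t (z * v ^+ p)%g = t by rewrite gset_actM tz gset_actX_fix.
  split=> //.
  - by rewrite (l1M t) lam1z tz add0r (cocycleX_fix l1M) // Fp_mulrn.
  - by rewrite psiM tz cocycleX_fix // Fp_mulrn // addr0.
  - by rewrite lam0M tz cocycleX_fix // lam0zE mulrDr -[_ *+ p]mulr_natl natz.
  - by rewrite rmorphD /= k0 add0r lam0v.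
pose Ja : gset G := ext_gset l0M.
pose l1a (q : Ja) x := modp (lam1 q.1 x).
have l1aM : cocycle l1a by move=> q x y; rewrite /l1a l1M.
pose J : gset G := ext_gset l1aM.
pose psiJ (q : J) x := psi q.1.1 x.
have psiJM : cocycle psiJ by move=> q x y; rewrite /psiJ psiM.
pose A0 : J -> G -> int := divided (fun q : J => lam0 q.1.1) (fun q : J => q.1.2).
have A0M : cocycle A0.
  by apply: divided_cocycle => // q x y; rewrite lam0M.
pose A1 : J -> G -> int := divided (fun q : J => lam1 q.1.1) (fun q : J => q.2).
have A1M : cocycle A1.
  by apply: divided_cocycle => // q x y; rewrite lam1M.
have a0M := modpM _ _ A0M.
have [|X XM XE] := transfer_cocycle psiJM a0M A1M.
  move=> [[t u0] u1]; have [z [k [tz lam1z psiz lam0z k0]]] := loops t; exists z.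
  have jz : gset_act (((t, u0), u1) : J) z = ((t, u0), u1).
    rewrite /gset_act /= /ext_act /= /gset_act /= /ext_act /= tz /l1a /= lam1z.
    have -> : modp (lam0 t z) = 0.
      by rewrite lam0z rmorphM /= -[p%:~R]/(p%:R) pchar_Fp_0 // mul0r.
    by rewrite !addr0.
  split=> //; suff -> : A0 (((t, u0), u1) : J) z = k by [].
  have p0 : p%:Z != 0 by rewrite eqz_nat -lt0n prime_gt0.
  by apply: (mulfI p0); rewrite divided_fix.
pose Jp := ext_gset psiJM.
pose T1 := ext_gset (cocycle_pull a0M (@ext_fst_equivariant _ _ _ _ psiJM)).
(* [L] makes the remaining cocycles divisible by [p] as well. The covers [L0], [L1] and [T3] prepare
   a second division, after which the values on [y ^+ (p ^ 2)] are the original ones on [y]. *)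
pose rowL (q : Jp) x : 'rV['F_p]_r := \row_i modp (lam i q.1.1.1 x).
have rowLM : cocycle rowL.
  by move=> q x y; apply/rowP => i; rewrite !mxE (lM i).
pose L : gset G := ext_gset rowLM.
pose B0 (q : L) x := A0 q.1.1 x.
have B0M : cocycle B0 by move=> q x y; rewrite /B0 A0M.
pose B1 (q : L) x := A1 q.1.1 x.
have B1M : cocycle B1 by move=> q x y; rewrite /B1 A1M.
pose B i : L -> G -> int :=
  divided (fun q : L => lam i q.1.1.1.1) (fun q : L => q.2 0 i).
have BM i : cocycle (B i).
  apply: divided_cocycle => // [q x y|q x]; first by rewrite lamM.
  by rewrite /= mxE mxE.
have b0M := modpM _ _ B0M; have b1M := modpM _ _ B1M.
pose L0 : gset G := ext_gset b0M.
pose b1' (q : L0) x := modp (B1 q.1 x).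
have b1'M : cocycle b1' by move=> q x y; rewrite /b1' b1M.
pose L1 : gset G := ext_gset b1'M.
pose rowB (q : L1) x : 'rV['F_p]_r := \row_i modp (B i q.1.1 x).
have rowBM : cocycle rowB.
  by move=> q x y; apply/rowP => i; rewrite !mxE (modpM _ _ (BM i)).
pose T3 : gset G := ext_gset rowBM.
pose C0 : T3 -> G -> int :=
  divided (fun q : T3 => B0 q.1.1.1) (fun q : T3 => q.1.1.2).
have C0M : cocycle C0.
  by apply: divided_cocycle => // q x y; rewrite B0M.
pose C1 : T3 -> G -> int :=
  divided (fun q : T3 => B1 q.1.1.1) (fun q : T3 => q.1.2).
have C1M : cocycle C1.
  by apply: divided_cocycle => // q x y; rewrite B1M.
pose C i : T3 -> G -> int :=
  divided (fun q : T3 => B i q.1.1.1) (fun q : T3 => q.2 0 i).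
have CM i : cocycle (C i).
  apply: divided_cocycle => // [q x y|q x]; first by rewrite BM.
  by rewrite /= mxE mxE.
pose f (q : T3) : T1 := (q.1.1.1.1, q.1.1.2).
have fE : equivariant f by [].
pose chi (q : T3) x := C0 q x + C1 q x - X (f q) x.
have chiM : cocycle chi.
  apply: cocycleD; first exact: cocycleD.
  exact/cocycleN/(cocycle_pull XM fE).
have fixL y : fixes T y -> fixes L (y ^+ p)%g.
  move=> Ty; have Tz : fixes T (y ^+ p)%g by move=> t; apply: gset_actX_fix.
  have Jaz : fixes Ja (y ^+ p)%g.
    by apply: ext_fixes => // t; rewrite (cocycleX_fix l0M) // Fp_mulrn.
  have Jz : fixes J (y ^+ p)%g.
    by apply: ext_fixes => // t; rewrite /l1a (cocycleX_fix l1M) // Fp_mulrn.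
  have Jpz : fixes Jp (y ^+ p)%g.
    apply: ext_fixes => // t.
    by rewrite /psiJ (cocycleX_fix psiM) // Fp_mulrn.
  apply: ext_fixes => // t; apply/rowP => i.
  by rewrite !mxE (cocycleX_fix (lM i)) // Fp_mulrn.
have fixT3 y : fixes T y -> fixes T3 (y ^+ (p ^ 2))%g.
  move=> Ty; have Lz := fixL y Ty; rewrite expgnA; set z := (y ^+ p)%g in Lz *.
  have Lzp : fixes L (z ^+ p)%g by move=> t; apply: gset_actX_fix.
  have L0z : fixes L0 (z ^+ p)%g.
    by apply: ext_fixes => // t; rewrite (cocycleX_fix b0M) // Fp_mulrn.
  have L1z : fixes L1 (z ^+ p)%g.
    by apply: ext_fixes => // t; rewrite /b1' (cocycleX_fix b1M) // Fp_mulrn.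
  apply: ext_fixes => // t; apply/rowP => i.
  by rewrite !mxE (cocycleX_fix (modpM _ _ (BM i))) // Fp_mulrn.
have fixJ y (q : J) : fixes T y -> gset_act q (y ^+ p)%g = q.
  move=> Ty.
  have := fixL y Ty ((q, 0), 0).
  by move/(congr1 (fun q : L => q.1.1)).
pose pi (q : T3) : T := q.1.1.1.1.1.1.1.
have piE : equivariant pi by [].
have A0E y (q : J) : fixes T y -> A0 q (y ^+ p)%g = lam0 q.1.1 y.
  by move=> Ty; apply: divided_pow => //; apply: fixJ.
have A1E y (q : J) : fixes T y -> A1 q (y ^+ p)%g = lam1 q.1.1 y.
  by move=> Ty; apply: divided_pow => //; apply: fixJ.
have BE y i (q : L) : fixes T y -> B i q (y ^+ p)%g = lam i q.1.1.1.1 y.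
  move=> Ty; apply: divided_pow => // [|t x]; first exact: fixL.
  by rewrite /= mxE mxE.
have fixT3' y q : fixes T y -> gset_act (q : T3) ((y ^+ p) ^+ p)%g = q.
  by move=> Ty; rewrite -expgnA; apply: fixT3.
have C0E y q : fixes T y -> C0 q ((y ^+ p) ^+ p)%g = lam0 (pi q) y.
  move=> Ty; rewrite -[RHS](A0E _ q.1.1.1.1.1) //.
  by apply: divided_pow => //; [apply: fixL | apply: fixT3'].
have C1E y q : fixes T y -> C1 q ((y ^+ p) ^+ p)%g = lam1 (pi q) y.
  move=> Ty; rewrite -[RHS](A1E _ q.1.1.1.1.1) //.
  by apply: divided_pow => //; [apply: fixL | apply: fixT3'].
have CE y i q : fixes T y -> C i q ((y ^+ p) ^+ p)%g = lam i (pi q) y.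
  move=> Ty; rewrite -[RHS](BE _ _ q.1.1.1) //.
  apply: divided_pow => // [||t x]; [exact: fixL | exact: fixT3' |].
  by rewrite /= mxE mxE.
have chiE y q : fixes T y -> modp (lam0 (pi q) y) != 0 \/ modp (lam1 (pi q) y) != 0 ->
    modp (chi q ((y ^+ p) ^+ p)%g) != 0.
  move=> Ty lam01; rewrite /chi rmorphB rmorphD /= C0E // C1E //.
  set z := (y ^+ p)%g; set j := q.1.1.1.1.1.
  have Lz : fixes L z by apply: fixL.
  have a0E : modp (A0 j z) = modp (lam0 (pi q) y) by rewrite A0E.
  have fz i : gset_act (f q) (z ^+ i)%g = (q.1.1.1.1, q.1.1.2 + modp (A0 j z) *+ i).
    rewrite /f /gset_act /= /ext_act /=; congr (_, _ + _).
      by have /(congr1 fst) := gset_actX_fix i (Lz q.1.1.1).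
    by rewrite (cocycleX_fix a0M) //; apply: fixJ.
  (* With [z = y ^+ p], the value of [X] on [z ^+ p] is a sum along the orbit of [z] in a fibre of
     [a0]. If [lam0] vanishes modulo [p] the orbit is a point and the sum is a multiple of [p];
     otherwise it is the whole fibre, and the sum is the transfer [A1]. *)
  rewrite (cocycleX XM).
  have [l0|l0] := eqVneq (modp (lam0 (pi q) y)) 0.
    rewrite (eq_bigr (fun=> X (f q) z)) => [|i _]; last first.
      by rewrite fz a0E l0 mul0rn addr0.
    rewrite sumr_const card_ord rmorphMn /= Fp_mulrn // l0 add0r subr0.
    by case: lam01; rewrite ?l0 ?eqxx.
  rewrite (eq_bigr (fun i : 'I_p =>
      X (q.1.1.1.1, q.1.1.2 + i%:R * modp (A0 j z)) z)) => [|i _]; last first.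
    by rewrite fz mulr_natl.
  rewrite (sum_Fp (fun i => X (q.1.1.1.1, q.1.1.2 + i * modp (A0 j z)) z)) //.
  have inj : injective (fun i : 'F_p => q.1.1.2 + i * modp (A0 j z)).
    by move=> i i' /addrI/mulIf; apply; rewrite a0E.
  have XE' (jp : Jp) : \sum_u X (jp, u) z = A1 jp.1 z by case: jp => j' s; apply: XE.
  have := XE' q.1.1.1.1; rewrite (reindex_inj inj) /= => ->.
  by rewrite A1E // addrK.
have [t0 _] : exists t0 : T, t0 \in T by apply/card_gt0P/ltnW.
pose q0 : T3 := ((((((((t0, 0), 0), 0), 0), 0), 0), 0)).
pose T' := orbit_gset q0.
have piE' : equivariant (fun q : T' => pi (val q)) by [].
exists T', (fun q => pi (val q)), (fun q x => chi (val q) x),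
  (fun i q x => C i (val q) x).
split; split=> //.
- exact: orbit_transitive.
- apply: leq_trans T_gt1 _.
  have surj t : exists q : T', pi (val q) = t.
    have [x <-] := Ttrans t0 t.
    by exists (gset_act (orbit_base q0) x); rewrite piE'.
  have [h hK] := boolp.choice surj.
  apply: (leq_card h) => s s' ss; by rewrite -(hK s) ss hK.
- by move=> i q x y; apply: CM.
move=> y Ty; split; first exact/orbit_fixes/fixT3.
by move=> q; rewrite expgnA; split=> [|i]; [apply: chiE | apply: CE].
Qed.

(** By induction, the first two cocycles are merged into one. If the first vanishes modulo [p] on
    all loops, it detects nothing and is dropped instead. *)
Lemma merge_cocycles (r : nat) (T : gset G) (lam : 'I_r.+1 -> T -> G -> int) :
  transitive_gset T -> (1 < #|T|)%N -> (forall i, cocycle (lam i)) ->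
  exists (T' : gset G) (pi : T' -> T) (chi : T' -> G -> int) (a : nat),
  [/\ equivariant pi, (0 < #|T'|)%N, cocycle chi &
    forall y, fixes T y -> fixes T' (y ^+ (p ^ a))%g /\
      forall t, (exists i, modp (lam i (pi t) y) != 0) ->
        modp (chi t (y ^+ (p ^ a))%g) != 0].
Proof.
elim: r T lam => [|r IHr] T lam Ttrans T_gt1 lamM.
  exists T, id, (lam ord0), 0%N; split=> // [|y Ty]; first exact: ltnW.
  by rewrite expg1; split=> // t [i]; rewrite ord1.
have [[t [v tv lam_v]]|triv] :=
    pselect (exists t, exists2 v, gset_act t v = t & modp (lam ord0 t v) != 0).
  have [||||T1 [pi1 [mu0 [mu [[T1trans T1_gt1 pi1E] [mu0M muM mu_P]]]]]] :=
    @merge_two T (lam ord0) (lam (lift ord0 ord0)) r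
      (fun i => lam (lift ord0 (lift ord0 i))) Ttrans T_gt1.
  - exact: lamM.
  - exact: lamM.
  - by move=> i; apply: lamM.
  - by exists t, v.
  pose nu (i : 'I_r.+1) := oapp mu mu0 (unlift ord0 i).
  have nuM i : cocycle (nu i) by rewrite /nu; case: (unlift ord0 i).
  have [T2 [pi2 [chi [a [pi2E T2_gt0 chiM chi_P]]]]] := IHr T1 nu T1trans T1_gt1 nuM.
  exists T2, (pi1 \o pi2), chi, (2 + a)%N; split=> // [q x|y Ty].
    by rewrite /= pi2E pi1E.
  rewrite expnD expgnA; have [T1y mu_y] := mu_P y Ty.
  have [T2y chi_y] := chi_P _ T1y; split=> // q [i].
  have [mu0_y muy] := mu_y (pi2 q).
  case: (unliftP ord0 i) => [i' ->|->] lam_y; last first.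
    apply: chi_y; exists ord0; rewrite /nu unlift_none /=.
    by apply: mu0_y; left.
  case: (unliftP ord0 i') lam_y => [k ->|->] lam_y; last first.
    apply: chi_y; exists ord0; rewrite /nu unlift_none /=.
    by apply: mu0_y; right.
  by apply: chi_y; exists (lift ord0 k); rewrite /nu liftK /= muy.
have [T' [pi [chi [a [piE T'_gt0 chiM chi_P]]]]] :=
  IHr T (fun i => lam (lift ord0 i)) Ttrans T_gt1 (fun i => lamM _).
exists T', pi, chi, a; split=> // y Ty; have [T'y chi_y] := chi_P y Ty.
split=> // t [i]; case: (unliftP ord0 i) => [i' ->|->] lam_y.
  by apply: chi_y; exists i'.
by case: triv; exists (pi t), y.
Qed.

(** Over a point [q] of the regular set, [x] is detected by the base cocycle of the conjugate
    [q * theta x * q^-1]. Merging the base cocycles of all elements of order [p] detects [x] over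
    every point. *)
Lemma prime_detector (Q : finGroupType) (theta : G -> Q) :
  {morph theta : x y / (x * y)%g} -> (forall q, exists x, theta x = q) ->
  (1 < #|Q|)%N ->
  exists (T : gset G) (chi : T -> G -> int) (a : nat),
  [/\ (0 < #|T|)%N, cocycle chi,
    forall y, theta y = 1%g -> fixes T (y ^+ (p ^ a))%g &
    forall x t, #[theta x]%g = p -> modp (chi t ((x ^+ p) ^+ (p ^ a))%g) != 0].
Proof.
move=> thetaM theta_surj Q_gt1; pose T0 := regular_gset thetaM.
have fixT0 y : theta y = 1%g -> fixes T0 y.
  by move=> y1 q; rewrite /gset_act /= /reg_act y1 mulg1.
have T0trans : transitive_gset T0.
  move=> q q'; have [x xE] := theta_surj (q^-1 * q')%g; exists x.
  by rewrite /gset_act /= /reg_act xE mulKVg.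
have base c : exists2 lam : T0 -> G -> int, cocycle lam &
    #[c]%g = p -> forall (t : Q) x, (t * theta x = c * t)%g ->
      modp (lam t (x ^+ p)%g) != 0.
  have [oc|oc] := eqVneq #[c]%g p; last first.
    (* Elements of other orders receive the zero cocycle, so that the family is indexed by all of
       [Q]. *)
    exists (fun _ _ => 0); first by move=> t x y; rewrite addr0.
    by move/eqP; rewrite (negbTE oc).
  have [lam lamM lamE] := base_cocycle thetaM theta_surj p_pr oc.
  by exists lam => // _ t x tx; rewrite -dvdz_Fp //; apply: lamE.
have {}base c : exists lam : T0 -> G -> int, cocycle lam /\
    (#[c]%g = p -> forall (t : Q) x, (t * theta x = c * t)%g ->
      modp (lam t (x ^+ p)%g) != 0).
  by have [lam lamM lamE] := base c; exists lam.
have [lam lamP] := boolp.choice base.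
have [r rE] : exists r, #|Q| = r.+1 by exists #|Q|.-1; rewrite prednK // ltnW.
pose nu (i : 'I_r.+1) := lam (enum_val (cast_ord (esym rE) i)).
have [T [pi [chi [a [piE T_gt0 chiM chi_P]]]]] :=
  @merge_cocycles r T0 nu T0trans Q_gt1 (fun i => (lamP _).1).
exists T, chi, a; split=> // [y y1|x t ox]; first by have [] := chi_P y (fixT0 y y1).
have xp1 : theta (x ^+ p)%g = 1%g.
  rewrite -ox -(expg_order (theta x)).
  elim: #[theta x]%g => [|k IHk]; first exact: morph_one thetaM.
  by rewrite !expgS thetaM IHk.
have [_] := chi_P _ (fixT0 _ xp1); apply.
pose c := (pi t * theta x * (pi t)^-1)%g.
exists (cast_ord rE (enum_rank c)); rewrite /nu cast_ordK enum_rankK.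
apply: (lamP c).2; last by rewrite /c mulgKV.
by rewrite /c -ox -(orderJ (theta x) (pi t)^-1%g) conjgE invgK mulgA.
Qed.

End Merge.

Lemma root_expr_neq1 (R : nzRingType) (z : R) (l m : nat) :
  (0 < m)%N -> coprime m l -> z ^+ l = 1 -> z != 1 -> z ^+ m != 1.
Proof.
move=> m_gt0 /eqP ml zl; apply: contra => /eqP zm.
case: (egcdnP l m_gt0) => u v uv _.
have : z ^+ (u * m) = z ^+ (v * l + 1) by rewrite uv ml.
by rewrite mulnC exprM zm expr1n exprD mulnC exprM zl expr1n mul1r expr1 => <-.
Qed.

(** * Roots of unity and the combination of the primes *)

Section Combine.
Variables g n : nat.
Local Notation G := (pi1_surface g n).
Hypothesis g_gt1 : (1 < g)%N.
Variables (Q : finGroupType) (theta : G -> Q).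
Hypotheses (thetaM : {morph theta : x y / (x * y)%g})
  (theta_surj : forall q, exists x, theta x = q) (Q_gt1 : (1 < #|Q|)%N).

Lemma thetaX x k : theta (x ^+ k)%g = (theta x ^+ k)%g.
Proof.
by elim: k => [|k IHk]; [exact: morph_one thetaM | rewrite !expgS thetaM IHk].
Qed.

Definition mult_cocycle (T : gset G) (xi : T -> G -> algC) :=
  (forall t, xi t 1%g = 1) /\
  (forall t x y, xi t (x * y)%g = xi t x * xi (gset_act t x) y).

Lemma mult_cocycleX_fix (T : gset G) (xi : T -> G -> algC) t x k :
  mult_cocycle xi -> gset_act t x = t -> xi t (x ^+ k)%g = xi t x ^+ k.
Proof.
move=> [xi1 xiM] tx; elim: k => [|k IHk]; first by rewrite xi1.
by rewrite expgS xiM tx IHk exprS.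
Qed.

Definition unit_gset : gset G :=
  @GSet G unit (fun t _ => t) (fun _ => erefl) (fun _ _ _ => erefl).

(** The detecting cocycle modulo [p] is exponentiated with a primitive [p]-th root of unity. On the
    cover [X] that it defines it becomes a coboundary, so elements fixing [X] act trivially on the
    twisted functions. *)
Lemma prime_root_detector (p : nat) : prime p ->
  exists (T X : gset G) (xi : T -> G -> algC) (E : nat),
  [/\ (0 < #|T|)%N /\ (0 < #|X|)%N, mult_cocycle xi,
    forall x, fixes X x -> fixes T x /\ forall t, xi t x = 1 &
    [/\ (0 < E)%N, forall q, prime q -> (q %| E)%N -> q = p,
      forall y, theta y = 1%g -> fixes X (y ^+ E)%g &
      forall x, #[theta x]%g = p -> forall t, exists k,
        [/\ (p %| k)%N, gset_act t (x ^+ k)%g = t, xi t (x ^+ k)%g != 1 &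
          xi t (x ^+ k)%g ^+ p = 1]]].
Proof.
move=> p_pr.
have [T [chi [a [T_gt0 chiM Tfix chi_P]]]] :=
  prime_detector g_gt1 p_pr thetaM theta_surj Q_gt1.
pose c t x : 'F_p := (chi t x)%:~R.
have cM : cocycle c by move=> t x y; rewrite /c chiM rmorphD.
have [w w_prim] := C_prim_root_exists (prime_gt0 p_pr).
pose xi t x := w ^+ (c t x : nat).
have xiD (u v : 'F_p) : w ^+ (u + v)%R = w ^+ u * w ^+ v.
  rewrite -exprD -[RHS](prim_expr_mod w_prim); congr (w ^+ _).
  by rewrite /=; congr (_ %% _)%N; apply: Fp_cast.
exists T, (ext_gset cM), xi, (p ^ a * p)%N; split.
- by rewrite card_prod muln_gt0 T_gt0 card_Fp ?prime_gt0.
- split=> [t|t x y]; first by rewrite /xi cocycle1 // expr0.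
  by rewrite /xi cM xiD.
- move=> x Xx; split=> t; have := Xx (t, 0).
    by move/(congr1 fst).
  by move/(congr1 snd); rewrite /gset_act /= add0r /xi => ->; rewrite expr0.
split=> [|q q_pr|y y1|x ox t].
- by rewrite muln_gt0 expn_gt0 prime_gt0.
- by rewrite -expnSr Euclid_dvdX // dvdn_prime2 // => /andP[/eqP].
- by rewrite expgnA; apply: ext_fixesX (Tfix _ y1) => v; apply: Fp_mulrn.
exists (p * p ^ a)%N; split.
- exact: dvdn_mulr.
- by rewrite expgnA; apply: Tfix; rewrite thetaX -ox expg_order.
- rewrite expgnA /xi -(prim_order_dvd w_prim).
  have /negP c0 := chi_P x t ox; apply/negP => pc; apply: c0.
  rewrite -/(c _ _); apply/eqP/val_inj => /=; apply/eqP.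
  have := ltn_ord (c t ((x ^+ p) ^+ (p ^ a))%g); rewrite [X in (_ < X)%N]Fp_cast //.
  by apply: contraTT; rewrite -lt0n -leqNgt => /dvdn_leq; apply.
- by rewrite /xi exprAC (prim_expr_order w_prim) expr1n.
Qed.

Lemma prod_fixes (T1 T2 : gset G) x :
  fixes T1 x -> fixes T2 x -> fixes (prod_gset T1 T2) x.
Proof. by move=> T1x T2x [t1 t2]; rewrite /gset_act /= /prod_act /= T1x T2x. Qed.

Lemma prod_fixes_inv (T1 T2 : gset G) x : (0 < #|T1|)%N -> (0 < #|T2|)%N ->
  fixes (prod_gset T1 T2) x -> fixes T1 x /\ fixes T2 x.
Proof.
move=> /card_gt0P[t1 _] /card_gt0P[t2 _] Tx; split=> t.
  by have /(congr1 fst) := Tx (t, t2).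
by have /(congr1 snd) := Tx (t1, t).
Qed.

(** For products, let [x ^+ k] be detected by one factor. It lies in the kernel of [theta], so
    raising it to the exponent [E] of the other factor makes it act trivially there. This exponent
    is prime to the order of the root of unity, which therefore stays nontrivial. *)
Lemma roots_detector (ps : seq nat) : all prime ps -> uniq ps ->
  exists (T X : gset G) (xi : T -> G -> algC) (E : nat),
  [/\ (0 < #|T|)%N /\ (0 < #|X|)%N, mult_cocycle xi,
    forall x, fixes X x -> fixes T x /\ forall t, xi t x = 1 &
    [/\ (0 < E)%N, forall q, prime q -> (q %| E)%N -> q \in ps,
      forall y, theta y = 1%g -> fixes X (y ^+ E)%g &
      forall x, #[theta x]%g \in ps -> forall t, exists k,
        [/\ (#[theta x]%g %| k)%N, gset_act t (x ^+ k)%g = t,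
          xi t (x ^+ k)%g != 1 & xi t (x ^+ k)%g ^+ #[theta x]%g = 1]]].
Proof.
elim: ps => [_ _|p ps IHps /= /andP[p_pr ps_pr] /andP[p_ps ps_uniq]].
  exists unit_gset, unit_gset, (fun _ _ => 1), 1%N; split=> //.
  - by rewrite card_unit.
  - by split=> // *; rewrite mulr1.
  by split=> // q q_pr; rewrite dvdn1 => /eqP q1; rewrite q1 in q_pr.
have [T1 [X1 [xi1 [E1 [[T1_gt0 X1_gt0] xi1M fix1 [E1_gt0 E1P K1 D1]]]]]] :=
  prime_root_detector p_pr.
have [T2 [X2 [xi2 [E2 [[T2_gt0 X2_gt0] xi2M fix2 [E2_gt0 E2P K2 D2]]]]]] :=
  IHps ps_pr ps_uniq.
pose xi (t : prod_gset T1 T2) x := xi1 t.1 x * xi2 t.2 x.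
exists (prod_gset T1 T2), (prod_gset X1 X2), xi, (E1 * E2)%N; split.
- by rewrite !card_prod !muln_gt0 T1_gt0 T2_gt0 X1_gt0.
- case: xi1M xi2M => [xi11 xi1M] [xi21 xi2M]; rewrite /xi.
  by split=> [t|t x y]; rewrite ?xi11 ?xi21 ?mulr1 // xi1M xi2M mulrACA.
- move=> x /(prod_fixes_inv X1_gt0 X2_gt0)[/fix1[T1x xi1x] /fix2[T2x xi2x]].
  by split=> [|t]; [exact: prod_fixes | rewrite /xi xi1x xi2x mulr1].
have Kexp y k : theta y = 1%g -> theta (y ^+ k)%g = 1%g.
  by move=> y1; rewrite thetaX // y1 expg1n.
have Korder x k : (#[theta x]%g %| k)%N -> theta (x ^+ k)%g = 1%g.
  by move=> xk; rewrite thetaX //; apply/eqP; rewrite -order_dvdn.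
split=> [|q q_pr|y y1|x].
- by rewrite muln_gt0 E1_gt0.
- rewrite Euclid_dvdM // inE => /orP[/(E1P _ q_pr) ->|/(E2P _ q_pr) ->].
    by rewrite eqxx.
  by rewrite orbT.
- apply: prod_fixes; rewrite expgnA; last exact/K2/Kexp.
  by move=> t; apply/gset_actX_fix/K1.
rewrite inE; have [ox _ [t1 t2]|xp /= xps [t1 t2]] := eqVneq #[theta x]%g p.
  have [k [pk kt1 xi1k xi1kp]] := D1 x ox t1; exists (k * E2)%N.
  have xk : (#[theta x]%g %| k)%N by rewrite ox.
  have [T2x xi2x] := fix2 _ (K2 _ (Korder x k xk)).
  have xiE : xi (t1, t2) ((x ^+ k) ^+ E2)%g = xi1 t1 (x ^+ k)%g ^+ E2.
    by rewrite /xi xi2x mulr1 mult_cocycleX_fix.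
  rewrite expgnA ox xiE; split; first exact: dvdn_mulr.
  - by rewrite /gset_act /= /prod_act /= T2x gset_actX_fix.
  - apply: (root_expr_neq1 E2_gt0 _ xi1kp xi1k); rewrite coprime_sym prime_coprime //.
    by apply: contra p_ps; apply: E2P.
  by rewrite exprAC xi1kp expr1n.
have [k [xk kt2 xi2k xi2kp]] := D2 x xps t2; exists (k * E1)%N.
have [T1x xi1x] := fix1 _ (K1 _ (Korder x k xk)).
have xiE : xi (t1, t2) ((x ^+ k) ^+ E1)%g = xi2 t2 (x ^+ k)%g ^+ E1.
  by rewrite /xi xi1x mul1r mult_cocycleX_fix.
rewrite expgnA xiE; split; first exact: dvdn_mulr.
- by rewrite /gset_act /= /prod_act /= T1x gset_actX_fix.
- have q_pr := allP ps_pr _ xps.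
  apply: (root_expr_neq1 E1_gt0 _ xi2kp xi2k); rewrite coprime_sym prime_coprime //.
  by apply: contra xp => /(E1P _ q_pr) ->.
by rewrite exprAC xi2kp expr1n.
Qed.

End Combine.

(** * From monomial modules to homology *)

Section HomologyFunctional.
Variables (S : groupType) (phi : S -> algC).
Hypothesis phiM : forall x y, phi (x * y)%g = phi x + phi y.

Let F : {malg rat[S]} -> algC := mmap (@ratr algC) phi.

Lemma functionalZ a u : F (a *: u) = ratr a * F u.
Proof.
rewrite /F (mmapEw (msuppZ_le _ _)) mmapE big_distrr /=.
by apply: eq_bigr => k _; rewrite mcoeffZ rmorphM -mulrA.
Qed.

Lemma functionalU x : F << x >> = phi x.
Proof. by rewrite /F mmapU [X in X * _]rmorph1 mul1r. Qed.

Lemma functional_boundary u : lspan (@bar_boundaries S) u -> F u = 0.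
Proof.
case=> s sB ->; rewrite /F raddf_sum /= -/F big_seq big1 // => p ps.
have [x [y ->]] := sB p ps; rewrite functionalZ.
rewrite /bar_d2 /F raddfD raddfB /= -/F !functionalU phiM.
by rewrite [phi x + _]addrC opprD addrA subrr add0r addNr mulr0.
Qed.

(** The linear extension [F] of [phi] to chains vanishes on boundaries, so [phi] induces a
    functional on homology; if it kills [A], it kills the span. *)
Lemma H1_class_lspan (A : set (H1 S)) r :
  (forall h, A h -> exists2 x, h = H1_class x & phi x = 0) ->
  lspan A (H1_class r) -> phi r = 0.
Proof.
move=> A0 [s sA rE].
have [u uE Fu] : exists2 u : {malg rat[S]},
    \sum_(q <- s) q.1 *: q.2 = to_span_quot (@bar_boundaries S) u & F u = 0.
  elim: s sA {rE} => [_|q s IHs sA].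
    exists 0; last exact: raddf0.
    rewrite big_nil; apply: (addrI (to_span_quot (@bar_boundaries S) 0)).
    by rewrite -to_span_quotD !addr0.
  have [|u uE Fu] := IHs; first by move=> q' q's; apply: sA; rewrite inE q's orbT.
  have [x qE phix] := A0 _ (sA q (mem_head _ _)).
  exists (q.1 *: << x >> + u).
    by rewrite big_cons uE qE to_span_quotD -span_quot_scaleE.
  by rewrite /F raddfD /= -/F functionalZ functionalU phix mulr0 Fu addr0.
move: rE; rewrite uE => /to_span_quotP/functional_boundary.
by rewrite /F raddfB /= -/F functionalU Fu subr0.
Qed.

End HomologyFunctional.

(** * The normal cover defined by a finite action *)

Section Kernel.
Variables (G : groupType) (X : gset G).

Definition act_perm (x : G) : {perm X} := perm (@gset_act_inj G X x).

Lemma act_permE x t : act_perm x t = gset_act t x.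
Proof. by rewrite permE. Qed.

Lemma act_permM x y : act_perm (x * y)%g = (act_perm x * act_perm y)%g.
Proof. by apply/permP => t; rewrite permM !act_permE gset_actM. Qed.

Definition act_kernel : {pred G} := fun x => act_perm x == 1%g.

Lemma act_kernelP x : reflect (fixes X x) (x \in act_kernel).
Proof.
apply: (iffP eqP) => [x1 t|Xx]; first by rewrite -act_permE x1 perm1.
by apply/permP => t; rewrite act_permE perm1.
Qed.

Lemma act_perm1 : act_perm 1%g = 1%g.
Proof. by apply/eqP/act_kernelP => t; rewrite gset_act1. Qed.

Lemma act_permV x : act_perm x^-1%g = (act_perm x)^-1%g.
Proof. by apply: (mulgI (act_perm x)); rewrite -act_permM !mulgV act_perm1. Qed.

Lemma act_permX x k : act_perm (x ^+ k)%g = (act_perm x ^+ k)%g.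
Proof.
by elim: k => [|k IHk]; [exact: act_perm1 | rewrite !expgS act_permM IHk].
Qed.

Lemma act_kernel_mul : mulg_closed act_kernel.
Proof.
by move=> x y /eqP x1 /eqP y1; apply/eqP; rewrite act_permM x1 y1 mulg1.
Qed.

Lemma act_kernel_one : 1%g \in act_kernel.
Proof. exact/eqP/act_perm1. Qed.

Lemma act_kernel_inv : invg_closed act_kernel.
Proof. by move=> x /eqP x1; apply/eqP; rewrite act_permV x1 invg1. Qed.

HB.instance Definition _ := isMulClosed.Build G act_kernel act_kernel_mul.
HB.instance Definition _ := isMul1Closed.Build G act_kernel act_kernel_one.
HB.instance Definition _ := isInvClosed.Build G act_kernel act_kernel_inv.

Definition act_kernel_closed : groupClosed G := act_kernel.

Lemma act_kernel_normal : normal_subgroup act_kernel_closed.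
Proof.
move=> x y /eqP x1; apply/eqP.
by rewrite conjgE !act_permM x1 mul1g act_permV mulVg.
Qed.

Definition act_image : {set {perm X}} := [set s | `[< exists x, act_perm x = s >]].

Lemma act_imageP s : reflect (exists x, act_perm x = s) (s \in act_image).
Proof. by rewrite inE; apply: asboolP. Qed.

Lemma act_image_group : group_set act_image.
Proof.
apply/group_setP; split; first by apply/act_imageP; exists 1%g; apply: act_perm1.
move=> s t /act_imageP[x <-] /act_imageP[y <-].
by apply/act_imageP; exists (x * y)%g; apply: act_permM.
Qed.

Lemma act_kernel_index : has_index act_kernel_closed #|act_image|.
Proof.
have hx (i : 'I_#|act_image|) : exists x, act_perm x = enum_val i.
  exact/act_imageP/enum_valP.
have [t tE] := boolp.choice hx; exists t => x.
have xi : act_perm x \in act_image by apply/act_imageP; exists x.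
have kE i : ((t i)^-1 * x)%g \in act_kernel_closed <-> enum_val i = act_perm x.
  rewrite -tE; split=> [/eqP|tx]; last first.
    by apply/eqP; rewrite act_permM act_permV tx mulVg.
  rewrite act_permM act_permV => /(congr1 (mulg (act_perm (t i)))).
  by rewrite mulKVg mulg1.
exists (enum_rank_in xi (act_perm x)); split=> [|i].
  by apply/kE; rewrite enum_rankK_in.
by move=> /kE xE; apply: enum_val_inj; rewrite enum_rankK_in.
Qed.

(** By Cauchy's theorem the image contains an element of order [p], and its [N]-th power is
    trivial. *)
Lemma act_image_prime (N : nat) : (forall x, fixes X (x ^+ N)%g) ->
  forall p, prime p -> (p %| #|act_image|)%N -> (p %| N)%N.
Proof.
move=> XN p p_pr pG.
have [s /act_imageP[x <-] <-] := @Cauchy _ p (Group act_image_group) p_pr pG.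
by rewrite order_dvdn -act_permX; apply/act_kernelP.
Qed.

End Kernel.

Lemma nontrivial_generator (X : choiceType) (rels : seq (word X))
    (Q : finGroupType) (theta : presented_group rels -> Q) :
  {morph theta : x y / (x * y)%g} -> (exists x, theta x != 1%g) ->
  exists x, theta (pgen rels x) != 1%g.
Proof.
move=> thetaM [y y1]; apply: contrapT => none; case/negP: y1.
have theta1 : theta 1%g = 1%g by apply: (mulgI (theta 1%g)); rewrite -thetaM !mulg1.
have gen1 x : theta (pgen rels x) = 1%g.
  by apply/eqP; apply: contrapT => x1; apply: none; exists x; apply/negP.
have [u ->] := of_word_repr y; elim: u => [|[x b] u IHu].
  by rewrite of_word_nil theta1.
rewrite -(cat1s (x, b) u) of_word_cat thetaM (eqP IHu) mulg1 of_word_letter.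
case: b; last by rewrite gen1.
by rewrite -(inj_eq (mulgI (theta (pgen rels x)))) -thetaM mulgV theta1 gen1 mulg1.
Qed.

(** * Crossed homomorphisms into the monomial module *)

Section MonomialModule.
Variables (G : groupType) (T X : gset G) (xi : T -> G -> algC).
Hypotheses (xi1 : forall t, xi t 1%g = 1)
  (xiM : forall t x y, xi t (x * y)%g = xi t x * xi (gset_act t x) y)
  (X_trivial : forall x, fixes X x -> fixes T x /\ forall t, xi t x = 1).
Let V := twisted_gmod xi1 xiM.
Let R : groupClosed G := act_kernel_closed X.
Variable c : G -> V.
Hypothesis cM : crossed c.

Lemma kernel_act x (v : V) : x \in R -> gmod_act x v = v.
Proof.
move=> /act_kernelP/X_trivial[Tx xix]; apply/ffunP => t.
by rewrite ffunE Tx xix mul1r.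
Qed.

(** At each point [t], invariance under a power of [x] fixing [t] says that [v t] equals its
    multiple by a scalar other than 1. *)
Lemma invariant_eq0 x (v : V) :
  (forall t, exists k, gset_act t (x ^+ k)%g = t /\ xi t (x ^+ k)%g != 1) ->
  gmod_act x v = v -> v = 0.
Proof.
move=> xP xv; apply/ffunP => t; rewrite [RHS]ffunE.
have xvk k : gmod_act (x ^+ k)%g v = v.
  elim: k => [|k IHk]; first exact: gmod_act1.
  by rewrite expgS gmod_actM IHk.
have [k [tk xik]] := xP t; have /ffunP/(_ t) := xvk k.
rewrite ffunE tk => /eqP; rewrite -subr_eq0 -[X in _ - X]mul1r -mulrBl mulf_eq0.
by rewrite subr_eq0 (negbTE xik) => /eqP.
Qed.

(* A crossed homomorphism vanishing on R is inflated from a finite group, hence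
   principal. *)
Lemma crossed_kernel_eq0 x : (forall r, r \in R -> c r = 0) ->
  (forall t, exists k, gset_act t (x ^+ k)%g = t /\ xi t (x ^+ k)%g != 1) ->
  c x = 0 -> forall z, c z = 0.
Proof.
move=> cR xP cx.
have hx s : exists y, s \in act_image X -> act_perm X y = s.
  have [/act_imageP[y ys]|_] := boolP (s \in act_image X); first by exists y.
  by exists 1%g.
have [h hE] := boolp.choice hx.
have c_perm y y' : act_perm X y = act_perm X y' -> c y = c y'.
  move=> yy'; have rR : (y^-1 * y')%g \in R.
    by apply/eqP; rewrite act_permM act_permV yy' mulVg.
  by rewrite -[y'](mulKVg y) cM (cR _ rR) gmod_act0 addr0.
(* Averaging over the finite image: summing the crossed rule gives [vE]. As [c x = 0], the sum [v]
   is fixed by [x] and so is 0, which leaves a positive multiple of [c z] equal to 0. *)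
pose v := \sum_(s in act_image X) c (h s).
have vE z : v = c z *+ #|act_image X| + gmod_act z v.
  have zI : act_perm X z \in act_image X by apply/act_imageP; exists z.
  have -> : gmod_act z v = \sum_(s in act_image X) gmod_act z (c (h s)).
    by rewrite /v (big_morph _ (@gmod_actD _ V z) (@gmod_act0 _ V z)).
  have zsI s : ((act_perm X z * s)%g \in act_image X) = (s \in act_image X).
    exact: (@groupMl _ (Group (act_image_group X)) _ s zI).
  rewrite -sumr_const -big_split /= /v (reindex_inj (mulgI (act_perm X z))).
  apply: eq_big => [s|s]; first exact: zsI.
  rewrite zsI -cM => sI; apply: c_perm.
  by rewrite act_permM !hE // zsI.
have v0 : v = 0.
  by apply: (invariant_eq0 xP); rewrite [RHS](vE x) cx mul0rn add0r.
move=> z; have := vE z; rewrite v0 gmod_act0 addr0 => /esym/ffunP cz.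
apply/ffunP => t; have := cz t; rewrite ffunMnE !ffunE => /eqP.
rewrite -mulr_natl mulf_eq0 Num.Theory.pnatr_eq0 => /orP[/eqP I0|/eqP //].
have : 1%g \in act_image X by apply/act_imageP; exists 1%g; apply: act_perm1.
by rewrite (cards0_eq I0) inE.
Qed.

(** Expanding [c (x * r) = c (r * x)], with [r] acting trivially, shows that [x] fixes [c r]. *)
Lemma crossed_commute_eq0 x r : r \in R -> commute x r ->
  (forall t, exists k, gset_act t (x ^+ k)%g = t /\ xi t (x ^+ k)%g != 1) ->
  c r = 0.
Proof.
move=> rR xr xP; apply: (invariant_eq0 xP).
by have := cM x r; rewrite xr cM kernel_act // addrC => /addrI.
Qed.

End MonomialModule.

Lemma expgz_commute (G : groupType) (x : G) (m : int) : commute x (expgz x m).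
Proof. by case: m => k; [|apply: commuteV]; apply/commuteX/commute_refl. Qed.

Local Close Scope ring_scope.

Theorem theorem2 (g n : nat) (hg : 2 <= g) (Q : finGroupType)
    (theta : {multiplicative pi1_surface g n -> Q})
    (theta_surj : forall q : Q, exists x, theta x = q)
    (Q_nontrivial : 1 < #|[set: Q]%G|)
    (Q_solvable : solvable [set: Q]%G)
    (Q_odd : odd #|[set: Q]%G|) :
  exists (R : groupClosed (pi1_surface g n)) (d : nat),
    [/\ normal_subgroup R,
        has_index R d,
        H1_neq1 theta R <> [set: H1 (subgroup_of R)]%classic &
        forall p, prime p -> p %| d -> p %| #|[set: Q]%G|].
Proof.
rewrite cardsT in Q_nontrivial *.
have thetaM : {morph theta : x y / (x * y)%g} by exact: gmulfM.
have ps_prime : all prime (primes #|Q|).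
  by apply/allP => p; rewrite mem_primes => /andP[].
have [T [X [xi [E [[T_gt0 X_gt0] [xi1 xiM] XT [E_gt0 EP K D]]]]]] :=
  roots_detector hg thetaM theta_surj Q_nontrivial ps_prime (primes_uniq _).
have detect x : theta x != 1%g -> forall t : T,
    exists k, gset_act t (x ^+ k)%g = t /\ xi t (x ^+ k)%g != 1%R.
  (* Passing to a power of [x] whose image in [Q] has prime order. *)
  move=> x1 t; pose p := pdiv #[theta x]%g.
  have p_pr : prime p by rewrite pdiv_prime // order_gt1.
  have p_ord : p %| #[theta x]%g := pdiv_dvd _.
  pose m := (#[theta x]%g %/ p)%N.
  have oxm : #[theta (x ^+ m)%g]%g = p.
    by rewrite thetaX // orderXdiv ?dvdn_div // divnA // mulKn.
  have [|k [_ tk xik _]] := D (x ^+ m)%g _ t.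
    rewrite oxm mem_primes p_pr /= (ltnW Q_nontrivial).
    by rewrite -cardsT (dvdn_trans p_ord) // order_dvdG // inE.
  by exists (m * k)%N; rewrite expgnA.
have [x0 x0E] : exists x, theta x != 1%g.
  have /card_gt1P[q [q' [_ _ qq']]] := Q_nontrivial.
  have [x xq] := theta_surj q; have [x' xq'] := theta_surj q'.
  have [q1|q1] := eqVneq q 1%g; last by exists x; rewrite xq.
  by exists x'; rewrite xq' eq_sym -q1.
have [s sE] := nontrivial_generator thetaM (ex_intro _ x0 x0E).
(* Requiring [c] to vanish at [s], outside the kernel of [theta], excludes principal crossed
   homomorphisms, since [s] fixes no nonzero vector. This costs [#|T|] conditions besides those of
   the relator. *)
have [|c cM [[z cz] c0]] := @crossed_exists g n algC T xi xi1 xiM T (fun=> pgen _ s) id.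
  have : 4 * #|T| <= (2 * g + n) * #|T| by rewrite leq_mul2r; apply/orP; right; lia.
  lia.
pose R : groupClosed (pi1_surface g n) := act_kernel_closed X.
have [r [rR cr]] : exists r, r \in R /\ (c r != 0)%R.
  apply: contrapT => none; case/eqP: cz.
  apply: (crossed_kernel_eq0 cM _ (detect _ sE)) => [r rR|].
    apply/eqP; apply: contrapT => /negP cr; apply: none.
    by exists r; split; [exact: rR | exact: cr].
  by apply/ffunP => t; rewrite c0 ffunE.
have [t crt] : exists t, (c r t != 0)%R.
  apply: contrapT => none; case/eqP: cr; apply/ffunP => t; rewrite ffunE.
  by apply/eqP; apply: contrapT => crt; apply: none; exists t; apply/negP.
exists R, #|act_image X|; split.
- exact: act_kernel_normal.
- exact: act_kernel_index.
(* [R] acts trivially, so a coordinate of [c] is a homomorphism on [R]. It vanishes on the powers in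
   [R] of any [x] outside the kernel, as these commute with [x], but not on [r]. *)
- pose phi (y : subgroup_of R) := c (val y) t.
  have phiM y y' : phi (y * y')%g = (phi y + phi y')%R.
    by rewrite /phi valM cM ffunE (kernel_act XT) // (valP y).
  move=> spanT; case/eqP: crt.
  have : H1_neq1 theta R (H1_class (Sub r rR)) by rewrite spanT.
  apply: (H1_class_lspan phiM) => h [x [m [xmR [/eqP x1 ->]]]].
  exists (Sub (expgz x m) xmR) => //.
  rewrite /phi /= (crossed_commute_eq0 XT cM xmR (expgz_commute x m) (detect x x1)).
  by rewrite ffunE.
(* The power [#|Q|] brings every element into the kernel of [theta], and the power [E], whose prime
   factors divide [#|Q|], then makes it fix [X]. *)
- move=> p p_pr /(act_image_prime _ p_pr) => /(_ (#|Q| * E)) pQE.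
  have : p %| #|Q| * E.
    apply: pQE => x; rewrite expgnA; apply: K.
    by rewrite thetaX // -cardsT expg_cardG ?inE.
  by rewrite Euclid_dvdM // => /orP[//|/(EP _ p_pr)]; rewrite mem_primes => /and3P[].
Qed.
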